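(* Let $(\Omega,\mathcal{F},\mathbb{P})$ be a nonatomic probability space, let $\mathcal{A}\subset L^\infty$ be a convex, law-invariant acceptance set, and let $1\le p<\infty$. The following statements are equivalent: (a) $\mathcal{R}_\mathcal{A}$ is $p$-robust on $\mathcal{M}_\infty$; (b) $\mathrm{Cl}_p(\mathcal{A})$ has nonempty interior in $L^p$. Moreover, $\mathrm{Index}_{\mathrm{qr}}(\rho_\mathcal{A})=1/\mathrm{Index}_{\mathrm{fin}}(\rho_\mathcal{A})$.
   Context: $L^p=L^p(\Omega,\mathcal{F},\mathbb{P})$ with the a.s. order; an acceptance set in $L^\infty$ is a nonempty proper $\mathcal{A}\subset L^\infty$ with $\mathcal{A}+L^\infty_+\subset\mathcal{A}$; it is law-invariant if $X\in\mathcal{A}$ whenever $X$ has the same law as some element of $\mathcal{A}$. $\mathrm{Cl}_p(\mathcal{A})$ is the closure of $\mathcal{A}$ in $L^p$. The cash-additive risk measure is $\rho_\mathcal{A}(X)=\inf\{m\in\mathbb{R}: X+m\in\mathcal{A}\}$, $X\in L^\infty$ (it is law-invariant). Let $\mathcal{M}_\infty=\{\mathbb{P}_X: X\in L^\infty\}$ be the set of laws of bounded random variables and define $\mathcal{R}_\mathcal{A}:\mathcal{M}_\infty\to\mathbb{R}$ by $\mathcal{R}_\mathcal{A}(\mathbb{P}_X)=\rho_\mathcal{A}(X)$. Let $\mathcal{M}$ be the Borel probability measures on $\mathbb{R}$ and $d_P$ the Prohorov metric. For $\mu\in\mathcal{M}$, let $(\Omega^\mu,\mathcal{F}^\mu,\mathbb{P}^\mu)$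 be a (nonatomic) probability space supporting an i.i.d. sequence $(X_n)$ with common law $\mu$, and let $m^\mu_n(\omega)=\frac1n\sum_{i=1}^n\delta_{X_i(\omega)}$ be the empirical distribution; $\mathcal{R}_\mathcal{A}(m^\mu_n)$ is the random variable $\omega\mapsto\mathcal{R}_\mathcal{A}(m^\mu_n(\omega))$, with law $\mathbb{P}^\mu_{\mathcal{R}_\mathcal{A}(m^\mu_n)}$. Let $\psi_p(x)=\frac1p|x|^p$. A set $\mathcal{N}\subset\mathcal{M}$ is uniformly $p$-integrating if $\lim_{M\to\infty}\sup_{\mu\in\mathcal{N}}\int_{\{\psi_p\ge M\}}\psi_p\,d\mu=0$. $\mathcal{R}_\mathcal{A}$ is $p$-robust on $\mathcal{M}_\infty$ if for every uniformly $p$-integrating $\mathcal{N}\subset\mathcal{M}_\infty$, every $\mu\in\mathcal{N}$ and $\varepsilon>0$ there exist $\delta>0$ and $n_0\in\mathbb{N}$ such that $d_P(\mu,\nu)+|\int\psi_p\,d\mu-\int\psi_p\,d\nu|\le\delta$ with $\nu\in\mathcal{N}$ implies $d_P(\mathbb{P}^\mu_{\mathcal{R}_\mathcal{A}(m^\mu_n)},\mathbb{P}^\nu_{\mathcal{R}_\mathcal{A}(m^\nu_n)})\le\varepsilon$ for all $n\ge n_0$. The index of qualitative robustness is $\mathrm{Index}_{\mathrm{qr}}(\rho_\mathcal{A})=(\inf\{p\in[1,\infty):\mathcal{R}_\mathcal{A}\text{ is }p\text{-robust on }\mathcal{M}_\infty\})^{-1}$ and the index of finiteness is $\mathrm{Index}_{\mathrm{fin}}(\rho_\mathcal{A})=\inf\{p\in[1,\infty):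 \mathrm{Cl}_p(\mathcal{A})\text{ has nonempty interior in }L^p\}$, with $\inf\emptyset=\infty$ and $1/\infty=0$. *)

(* Defs.v *)
From HB Require Import structures.
From mathcomp Require Import all_boot all_order all_algebra.
From mathcomp Require Import all_classical all_reals all_analysis.
Set Implicit Arguments. Unset Strict Implicit. Unset Printing Implicit Defensive.
Import Order.TTheory GRing.Theory Num.Theory.
Import numFieldNormedType.Exports.
Local Open Scope classical_set_scope.
Local Open Scope ring_scope.

Section Defs.
Context {R : realType}.

Section Space.
Context {d : measure_display} {T : measurableType d}.
Variable P : probability T R.

Definition nonatomic : Prop :=
  forall A : set T, measurable A -> (0 < P A)%E ->
  exists B : set T, [/\ measurable B, B `<=` A, (0 < P B)%E & (P B < P A)%E].

(** random variables in L^infty (functions; L^infty-classes are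
    represented by their members) *)
Definition Linf (X : T -> R) : Prop :=
  measurable_fun setT X /\ exists c : R, {ae P, forall w, `|X w| <= c}.

Definition Lp (p : R) (X : T -> R) : Prop :=
  measurable_fun setT X /\ ('N[P]_(p%:E)[EFin \o X] < +oo)%E.

Definition Lpdist (p : R) (X Y : T -> R) : \bar R :=
  'N[P]_(p%:E)[EFin \o (X \- Y)].

Definition same_law {d' : measure_display} {T' : measurableType d'}
  (Q : probability T' R) (X : T -> R) (Y : T' -> R) : Prop :=
  forall B : set R, measurable B -> P (X @^-1` B) = Q (Y @^-1` B).

Definition acceptance_set (A : set (T -> R)) : Prop :=
  [/\ (forall X, A X -> Linf X),
      (exists X, A X),
      (exists X, Linf X /\ ~ A X) &
      (forall X Y, A X -> Linf Y -> {ae P, forall w, 0 <= Y w} -> A (X \+ Y))].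

Definition convex_acc (A : set (T -> R)) : Prop :=
  forall X Y, A X -> A Y -> forall l : R, 0 <= l <= 1 ->
    A (fun w => l * X w + (1 - l) * Y w).

Definition law_invariant (A : set (T -> R)) : Prop :=
  forall X Y, A X -> Linf Y -> same_law P X Y -> A Y.

Definition Clp (p : R) (A : set (T -> R)) : set (T -> R) :=
  fun Y => Lp p Y /\
    forall e : R, 0 < e -> exists Z, A Z /\ (Lpdist p Y Z < e%:E)%E.

Definition Lp_interior_nonempty (p : R) (A : set (T -> R)) : Prop :=
  exists X, Lp p X /\ exists e : R, 0 < e /\
    forall Y, Lp p Y -> (Lpdist p Y X < e%:E)%E -> Clp p A Y.

Definition rho (A : set (T -> R)) (X : T -> R) : R :=
  inf [set m : R | A (fun w => X w + m)].

Definition Minf (mu : set R -> \bar R) : Prop :=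
  exists X, Linf X /\ forall B : set R, measurable B -> P (X @^-1` B) = mu B.

(** R_A(mu) := rho_A(X) for a bounded X with law mu
    (well defined on M_infty by law invariance) *)
Definition RA (A : set (T -> R)) (mu : set R -> \bar R) : R :=
  rho A (xget (fun _ => 0)
    [set X | Linf X /\ forall B : set R, measurable B -> P (X @^-1` B) = mu B]).

End Space.

Definition nbhd_set (A : set R) (e : R) : set R :=
  [set x | exists2 a, A a & `|x - a| < e].

Definition prohorov (mu nu : set R -> \bar R) : R :=
  inf [set e : R | 0 < e /\ forall A : set R, measurable A ->
         (mu A <= nu (nbhd_set A e) + e%:E)%E /\
         (nu A <= mu (nbhd_set A e) + e%:E)%E].

Definition psi (p : R) (x : R) : R := p^-1 * `|x| `^ p.

Definition unif_p_integrating (p : R) (N : set (probability R R)) : Prop :=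
  forall e : R, 0 < e -> exists M0 : R, forall M : R, M0 <= M ->
    forall mu, N mu ->
      (\int[mu]_(x in [set x | (M <= psi p x)%R]) (psi p x)%:E <= e%:E)%E.

Definition int_psi (p : R) (mu : probability R R) : \bar R :=
  \int[mu]_x (psi p x)%:E.

Definition empirical (n : nat) (x : nat -> R) : set R -> \bar R :=
  fun B => (n%:R^-1 * \sum_(i < n) \1_B (x i))%:E.

Definition iid {d' : measure_display} {T' : measurableType d'}
  (Q : probability T' R) (mu : probability R R) (X : nat -> T' -> R) : Prop :=
  [/\ forall i, measurable_fun setT (X i),
      forall i (B : set R), measurable B -> Q (X i @^-1` B) = mu B &
      forall n (B : nat -> set R), (forall i, measurable (B i)) ->
        Q (\bigcap_(i in `I_n) (X i @^-1` B i)) =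
        (\prod_(i < n) Q (X i @^-1` B i))%E].

Definition law_RA_emp {d : measure_display} {T : measurableType d}
  (P : probability T R) (A : set (T -> R))
  {d' : measure_display} {T' : measurableType d'}
  (Q : probability T' R) (X : nat -> T' -> R) (n : nat) : set R -> \bar R :=
  fun B => Q ((fun w => RA P A (empirical n (fun i => X i w))) @^-1` B).

(** p-robustness of R_A on M_infty.  The law of R_A(m_n^mu) does not
    depend on the chosen (nonatomic) space carrying the i.i.d. sequence;
    we quantify over all such realizations. *)
Definition p_robust {d : measure_display} {T : measurableType d}
  (P : probability T R) (A : set (T -> R)) (p : R) : Prop :=
  forall N : set (probability R R),
    (forall mu, N mu -> Minf P mu) -> unif_p_integrating p N ->
  forall mu, N mu -> forall e : R, 0 < e ->
  exists delta : R, 0 < delta /\ exists n0 : nat,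
  forall nu, N nu ->
    ((prohorov mu nu)%:E + `| int_psi p mu - int_psi p nu | <= delta%:E)%E ->
  forall (d1 : measure_display) (T1 : measurableType d1) (P1 : probability T1 R)
         (X : nat -> T1 -> R), nonatomic P1 -> iid P1 mu X ->
  forall (d2 : measure_display) (T2 : measurableType d2) (P2 : probability T2 R)
         (Y : nat -> T2 -> R), nonatomic P2 -> iid P2 nu Y ->
  forall n : nat, (0 < n)%N -> (n0 <= n)%N ->
    prohorov (law_RA_emp P A P1 X n) (law_RA_emp P A P2 Y n) <= e.

(** 1/x on [1, +oo], with 1/+oo = 0 *)
Definition einv (x : \bar R) : \bar R :=
  match x with
  | r%:E => (r^-1)%:E
  | _ => 0%E
  end.

Definition Index_qr {d : measure_display} {T : measurableType d}
  (P : probability T R) (A : set (T -> R)) : \bar R :=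
  einv (ereal_inf [set p%:E | p in [set p : R | 1 <= p /\ p_robust P A p]]).

Definition Index_fin {d : measure_display} {T : measurableType d}
  (P : probability T R) (A : set (T -> R)) : \bar R :=
  ereal_inf [set p%:E | p in [set p : R | 1 <= p /\ Lp_interior_nonempty P p A]].

End Defs.

(* Main.v *)
(** Write [rho] for the cash-additive risk measure of [A]; it is finite, monotone,
convex and law-invariant.  Both statements are shown to be equivalent to: [rho] is
bounded above on the bounded [X] with [E|X|^p <= e], for some [e > 0].

Nonatomicity and law invariance give [rho (E[Z|G]) <= rho Z] for finite partitions
[G]: averaging the cyclic shifts of a rearrangement of [Z] on equally likely pieces of
the cells of [G] approximates the conditional expectation uniformly.  As conditional
expectation on a finite partition turns L^p convergence into uniform convergence, the
bounded elements of [Cl_p(A)] satisfy [rho <= 0], so an interior point of [Cl_p(A)]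
bounds [rho] near [0]; the converse follows by truncation.

If [rho] is bounded near [0], convexity makes it L^p continuous at every bounded [X].
An empirical measure with almost the right frequencies on a fine grid and a small
[p]-th moment in the tail can be coupled to [X] with small L^p distance.  Chebyshev's
inequality for the finitely many frequencies and Markov's inequality for the tail are
uniform over a uniformly [p]-integrating set, hence so is the concentration of the
empirical risks around [rho X].

If [rho] is unbounded near [0], there are simple [X_k] tending to [0] in L^p with
[rho X_k > rho 0 + 2].  The empirical risks of the law of [X_k] asymptotically exceed
[rho X_k - 1], again by the conditional expectation inequality, which contradicts
robustness at the Dirac mass at [0]. *)

Require Import Defs.
From HB Require Import structures.
From mathcomp Require Import all_boot all_order all_algebra.
From mathcomp Require Import all_classical all_reals all_analysis.
From mathcomp Require Import measurable_realfun ring lra.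
Set Implicit Arguments.
Unset Strict Implicit.
Unset Printing Implicit Defensive.
Import Order.TTheory GRing.Theory Num.Theory.
Import numFieldNormedType.Exports.
Local Open Scope classical_set_scope.
Local Open Scope ring_scope.

(** * Finite partitions of a nonatomic space *)

(** The only continuity of [rho] known at the start is the Lipschitz bound in the sup norm;
    closeness in L^p or in law gives no direct control. The conditional expectation inequality makes
    up for this, but in one direction only. It is stated through integrals over the cells of a
    finite partition, with an error eta: null cells are then harmless and no conditional expectation
    has to be constructed.

    Robustness speaks of samples on arbitrary spaces, but the risk of an empirical measure depends
    on the sample points alone. It is always realized on Omega itself, as a function of n cells of
    mass 1/n, and a coupling compares it there with X.

    The gap 2 above [rho 0] has two uses: one unit pays for the passage from [rho] to the empirical
    risk, the other exceeds the Prohorov radius 3/4 that robustness leaves. *)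

Definition Pr {R : realType} {d} {T : measurableType d}
  (P : probability T R) (S : set T) : R := fine (P S).

(** A finite measurable partition, given by labels with measurable fibres, so that the label type
    carries no sigma-algebra. *)
Definition mclass {d} {T : measurableType d} {I : Type} (c : T -> I) : Prop :=
  forall k, measurable (c @^-1` [set k]).

Section Probability.
Context {R : realType} {d : measure_display} {T : measurableType d}.
Variable P : probability T R.
Implicit Types S B : set T.

Lemma PrE S : measurable S -> P S = (Pr P S)%:E.
Proof. by move=> mS; rewrite fineK// fin_num_measure. Qed.

Lemma Pr_ge0 S : 0 <= Pr P S.
Proof. exact: fine_ge0. Qed.

Lemma Pr0 : Pr P set0 = 0.
Proof. by rewrite /Pr measure0. Qed.

Lemma PrT : Pr P setT = 1.
Proof. by rewrite /Pr probability_setT. Qed.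

Lemma le_Pr S B : measurable S -> measurable B -> S `<=` B -> Pr P S <= Pr P B.
Proof.
by move=> mS mB SB; rewrite -lee_fin -!PrE//; apply: le_measure; rewrite ?inE.
Qed.

Lemma Pr_le1 S : measurable S -> Pr P S <= 1.
Proof. by move=> mS; rewrite -PrT; apply: le_Pr. Qed.

Lemma PrU S B : measurable S -> measurable B -> S `&` B = set0 ->
  Pr P (S `|` B) = Pr P S + Pr P B.
Proof.
move=> mS mB dSB; apply: EFin_inj.
by rewrite EFinD -!PrE//; [exact: measureU|exact: measurableU].
Qed.

Lemma PrD S B : measurable S -> measurable B -> B `<=` S ->
  Pr P (S `\` B) = Pr P S - Pr P B.
Proof.
move=> mS mB BS; rewrite -{2}(setDUK BS) PrU//.
- by rewrite addrAC subrr add0r.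
- exact: measurableD.
- by apply/seteqP; split => x // [? []].
Qed.

Lemma PrC S : measurable S -> Pr P (~` S) = 1 - Pr P S.
Proof. by move=> mS; rewrite -PrT -PrD// setTD. Qed.

Lemma le_PrU S B : measurable S -> measurable B ->
  Pr P (S `|` B) <= Pr P S + Pr P B.
Proof.
move=> mS mB; rewrite -lee_fin EFinD -!PrE//; last exact: measurableU.
exact: measureU2.
Qed.

Lemma Pr_bigcup (I : finType) (F : I -> set T) :
  (forall i, measurable (F i)) -> (forall i j, i != j -> F i `&` F j = set0) ->
  Pr P (\bigcup_i F i) = \sum_i Pr P (F i).
Proof.
move=> mF dF; apply: EFin_inj; rewrite -sumEFin -PrE; last first.
  by apply: fin_bigcup_measurable => //; exact: finite_finset.
have tF : trivIset setT F by apply/trivIsetP => i j _ _; exact: dF.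
rewrite (measure_fin_bigcup _ finite_finset tF)//.
transitivity (\sum_(i : I) P (F i))%E; last by apply: eq_bigr => i _; exact: PrE.
rewrite (fsbig_seq _ _ (index_enum_uniq I)).
have -> // : [set` index_enum I] = setT.
by apply/seteqP; split => i //= _; rewrite mem_index_enum.
Qed.

Lemma le_Pr_bigcup (I : finType) (F : I -> set T) :
  (forall i, measurable (F i)) -> Pr P (\bigcup_i F i) <= \sum_i Pr P (F i).
Proof.
move=> mF; have -> : \bigcup_i F i = \big[setU/set0]_(i <- index_enum I) F i.
  by rewrite -bigcup_seq; apply/seteqP; split => x [i /= _ Fix];
    exists i => //=; rewrite mem_index_enum.
elim: (index_enum I) => [|i s IH]; first by rewrite !big_nil /Pr measure0.
rewrite !big_cons (le_trans (le_PrU _ _))// ?lerD2l//.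
by apply: bigsetU_measurable.
Qed.

Lemma Pr_sum (I : finType) (c : T -> I) S : mclass c -> measurable S ->
  Pr P S = \sum_k Pr P (S `&` c @^-1` [set k]).
Proof.
move=> mc mS; rewrite -Pr_bigcup.
- by congr (Pr P _); apply/seteqP; split => [x Sx|x [k _ []]//]; exists (c x).
- by move=> i; apply: measurableI.
- by move=> i j /eqP ij; rewrite -subset0 => x [[_ /= xi] [_ /= xj]]; apply: ij; rewrite
  -xi.
Qed.
End Probability.

(** * Sierpinski's theorem: subsets of prescribed mass *)

Section Nonatomic.
Context {R : realType} {d : measure_display} {T : measurableType d}.
Variable P : probability T R.
Hypothesis naP : nonatomic P.
Implicit Types S B C : set T.

Lemma small_subset S (e : R) : measurable S -> 0 < Pr P S -> 0 < e ->
  exists B, [/\ measurable B, B `<=` S, 0 < Pr P B & Pr P B < e].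
Proof.
move=> mS S0 e0.
(* One of [C] and its complement in [B] has at most half of the mass. The bound 1/(n+1), weaker than
   2^-n, already fits the Archimedean property. *)
have half n : exists B, [/\ measurable B, B `<=` S, 0 < Pr P B
    & Pr P B * n.+1%:R <= 1].
  elim: n => [|n [B [mB BS B0 Bn]]].
    by exists S; split => //; rewrite mulr1 Pr_le1.
  have [|C [mC CB]] := naP mB; first by rewrite PrE// lte_fin.
  rewrite !PrE// !lte_fin => C0 CltB.
  have PBC := PrD P mB mC CB.
  have n1 : 1 <= n.+1%:R :> R by rewrite ler1n.
  have [leC|ltC] := leP (Pr P C) (Pr P B / 2).
    exists C; split => //; first exact: subset_trans BS.
    by rewrite -(addn1 n.+1) natrD; nra.
  exists (B `\` C); split; [exact: measurableD| |lra|].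
    exact: subset_trans (@subDsetl _ _ _) BS.
  by rewrite -(addn1 n.+1) natrD; nra.
have [B [mB BS B0 Bn]] := half (Num.bound e^-1).
exists B; split => //.
have einv : e^-1 < (Num.bound e^-1).+1%:R.
  rewrite (lt_trans (archi_boundP _)) ?invr_ge0 ?ltW// ltr_nat//.
rewrite -(ltr_pM2r (_ : 0 < e^-1)) ?invr_gt0// mulfV ?gt_eqF//.
by rewrite (lt_le_trans _ Bn)// ltr_pM2l.
Qed.

(* One step of the exhaustion argument: [C] captures at least half of what can
   still be added to [B] without exceeding the mass [t]. *)
Let greedy S (t : R) B C :=
  [/\ measurable C, C `<=` S `\` B, Pr P B + Pr P C <= t
    & forall D, measurable D -> D `<=` S `\` B -> Pr P B + Pr P D <= t ->
      Pr P D <= 2 * Pr P C].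

Let greedy_ex S (t : R) B : measurable B -> Pr P B <= t -> exists C, greedy S t B C.
Proof.
move=> mB Bt; pose E := [set x | exists D, [/\ measurable D, D `<=` S `\` B,
  Pr P B + Pr P D <= t & x = Pr P D]].
have E0 : E 0.
  by exists set0; split; [by []|by []|by rewrite Pr0 addr0|by rewrite Pr0].
have ubE : ubound E 1 by move=> x [D [mD _ _ ->]]; exact: Pr_le1.
have hE : has_sup E by split; [exists 0|exists 1].
have [s0|s0] := ltP 0 (sup E); last first.
  exists set0; split; [by []|by []|by rewrite Pr0 addr0|].
  move=> D mD DSB BD; rewrite Pr0 mulr0 (le_trans _ s0)//; apply: (sup_upper_bound hE).
  by exists D; split.
have [x [C [mC CS BC ->]] Cs] := sup_adherent (divr_gt0 s0 (ltr0n R 2)) hE.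
exists C; split => // D mD DS BD.
have ED : E (Pr P D) by exists D; split.
by have := sup_upper_bound hE ED; lra.
Qed.

Theorem sierpinski S (t : R) : measurable S -> 0 <= t <= Pr P S ->
  exists B, [/\ measurable B, B `<=` S & Pr P B = t].
Proof.
move=> mS /andP[t0 tS].
pose nxt B := xget set0 [set C | greedy S t B C].
pose U := fix U n := if n is n'.+1 then U n' `|` nxt (U n') else set0.
have UP n : [/\ measurable (U n), U n `<=` S & Pr P (U n) <= t].
  elim: n => [|n [mU US Ut]]; first by split; rewrite /= ?Pr0.
  have [C gC] := greedy_ex S mU Ut.
  have [mN NS Nt _] : greedy S t (U n) (nxt (U n)) by apply: xgetPex; exists C.
  split; first exact: measurableU.
  - by rewrite subUset; split => // x /NS[].
  - by rewrite PrU//; apply/seteqP; split => // x [? /NS[]].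
have NP n : greedy S t (U n) (nxt (U n)).
  by have [mU _ Ut] := UP n; have [C gC] := greedy_ex S mU Ut; apply: xgetPex; exists C.
have mU n : measurable (U n) by have [] := UP n.
pose V := \bigcup_n U n.
have mV : measurable V by exact: bigcupT_measurable.
have VS : V `<=` S by move=> x [n _ Ux]; have [_ + _] := UP n; apply.
have UV n : U n `<=` V by move=> x Ux; exists n.
have Vt : Pr P V <= t.
  have cvV : P \o U @ \oo --> P V.
    apply: nondecreasing_cvg_mu => //.
    by apply/nondecreasing_seqP => n; rewrite subsetEset /=; left.
  rewrite -lee_fin -PrE//; apply: (cvge_le _ cvV); apply: nearW => n /=.
  by rewrite PrE// lee_fin; have [] := UP n.
exists V; split => //; apply/eqP; rewrite eq_le Vt/= leNgt; apply/negP => Vlt.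
have VD := PrD P mS mV VS.
(* If the mass t were missed, one small piece [D] would remain admissible at every step, so every
   step would gain at least half of its mass, against total mass 1. *)
have [|||D [mD DS D0 Dlt]] := @small_subset (S `\` V) (t - Pr P V).
- exact: measurableD.
- lra.
- lra.
have Nn n : Pr P D <= 2 * Pr P (nxt (U n)).
  have [_ _ _] := NP n; apply => //.
    by move=> x /DS[Sx Vx]; split => // Ux; apply: Vx; exact: (UV n).
  by have := le_Pr P (mU n) mV (UV n); lra.
have Un n : n%:R * Pr P D <= 2 * Pr P (U n).
  elim: n => [|n IH]; first by rewrite mul0r mulr_ge0// Pr_ge0.
  have [mN NS _ _] := NP n.
  rewrite [U n.+1]/= PrU//; last by apply/seteqP; split => // x [? /NS[]].
  by rewrite -addn1 natrD; have := Nn n; lra.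
have := archi_boundP (_ : 0 <= 2 / Pr P D); rewrite divr_ge0 ?Pr_ge0// => /(_ isT).
rewrite ltr_pdivrMr// => /lt_le_trans/(_ (Un _)).
by have := Pr_le1 P (mU (Num.bound (2 / Pr P D))); lra.
Qed.

(** Sierpinski's theorem carves off the labels one by one; the last label takes the remainder, whose
    mass is right because the weights sum to that of [S]. Only the traces on [S] of the fibres are
    controlled. *)
Lemma split_weights (I : finType) (i0 : I) S (u : I -> R) : measurable S ->
  (forall i, 0 <= u i) -> \sum_i u i = Pr P S ->
  exists f : T -> I, forall i,
    measurable (S `&` f @^-1` [set i]) /\ Pr P (S `&` f @^-1` [set i]) = u i.
Proof.
move=> mS u0 uS.
have main : forall (s : seq I) (i1 : I) S', uniq (i1 :: s) -> measurable S' ->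
    \sum_(i <- i1 :: s) u i = Pr P S' ->
    exists f : T -> I, (forall x, f x \in i1 :: s) /\ forall i, i \in i1 :: s ->
      measurable (S' `&` f @^-1` [set i]) /\ Pr P (S' `&` f @^-1` [set i]) = u i.
  elim => [|i2 s IH] i1 S' us mS' sum_u.
    exists (fun=> i1); split => [x|i]; rewrite ?inE// => /eqP ->.
    rewrite (_ : _ `&` _ = S'); last by apply/seteqP; split => // x [].
    by split => //; rewrite -sum_u big_seq1.
  move: us; rewrite cons_uniq => /andP[i1s us].
  move: sum_u; rewrite big_cons => sum_u.
  have [|B [mB BS PB]] := @sierpinski S' (u i1) mS'.
    by rewrite u0 -sum_u lerDl sumr_ge0.
  have [|f [fs fP]] := IH i2 (S' `\` B) us (measurableD mS' mB).
    by rewrite PrD// PB -sum_u addrAC subrr add0r.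
  exists (fun x => if x \in B then i1 else f x); split.
    by move=> x; rewrite in_cons; case: ifP; rewrite ?eqxx// fs orbT.
  move=> i; rewrite in_cons => /orP[/eqP ->|is2].
    rewrite (_ : _ `&` _ = B)//; apply/seteqP; split => x /=.
      by case; case: ifPn => [/set_mem//|_ _ fx]; have := fs x; rewrite fx (negbTE i1s).
    by move=> Bx; split; [exact: BS|rewrite mem_set].
  have ne : i1 <> i by move=> ii; rewrite ii is2 in i1s.
  rewrite (_ : _ `&` _ = (S' `\` B) `&` f @^-1` [set i]); first exact: fP.
  apply/seteqP; split => x /=.
    by case: ifPn => [_ [] //|/negP Bx [Sx fx]]; split => //; split => // /mem_set.
  by move=> [[Sx Bx] fx]; case: ifPn => [/set_mem//|].
have /= := main (rem i0 (index_enum I)) i0 S.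
have pe : perm_eq (index_enum I) (i0 :: rem i0 (index_enum I)).
  by rewrite perm_to_rem// mem_index_enum.
rewrite -/(uniq (i0 :: _)) -(perm_uniq pe) index_enum_uniq -(perm_big _ pe)/=.
move=> /(_ isT mS uS) [f [_ fP]]; exists f => i; apply: fP.
by rewrite -(perm_mem pe) mem_index_enum.
Qed.
End Nonatomic.

(** Boundedness at every point, not just almost surely, keeps exceptional sets out of the pointwise
    estimates; members of [Linf] are brought to this form by clipping. *)
Definition bmeas {R : realType} {d} {T : measurableType d} (X : T -> R) : Prop :=
  measurable_fun setT X /\ exists K, forall w, `|X w| <= K.

Section FiniteClasses.
Context {R : realType} {d : measure_display} {T : measurableType d}.
Variable P : probability T R.

Lemma mclass_preimage (I : finType) (c : T -> I) (D : set I) :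
  mclass c -> measurable (c @^-1` D).
Proof.
move=> mc; rewrite (_ : c @^-1` D = \bigcup_(k in D) (c @^-1` [set k])).
  by apply: fin_bigcup_measurable => //; exact: finite_finset.
by apply/seteqP; split => [x Dx|x [k Dk /= ->]//]; exists (c x).
Qed.

Lemma mclass_pair (I J : finType) (c : T -> I) (b : T -> J) :
  mclass c -> mclass b -> mclass (fun w => (c w, b w)).
Proof.
move=> mc mb [i j]; rewrite (_ : _ @^-1` _ = c @^-1` [set i] `&` b @^-1` [set j]).
  exact: measurableI.
by apply/seteqP; split => x /= [-> ->].
Qed.

Lemma mclass_fun (I : finType) (c : T -> I) (v : I -> R) :
  mclass c -> measurable_fun setT (v \o c).
Proof. by move=> mc _ B mB; rewrite setTI; exact: (mclass_preimage (v @^-1` B)). Qed.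

Lemma mclass_bmeas (I : finType) (c : T -> I) (v : I -> R) :
  mclass c -> bmeas (v \o c).
Proof.
move=> mc; split; first exact: mclass_fun.
exists (\sum_k `|v k|) => w /=; rewrite (bigD1 (c w))//= lerDl.
exact: sumr_ge0.
Qed.

Lemma Pr_preimage (I : finType) (c : T -> I) (D : set I) : mclass c ->
  Pr P (c @^-1` D) = \sum_(k | k \in D) Pr P (c @^-1` [set k]).
Proof.
move=> mc; rewrite (Pr_sum P mc (mclass_preimage D mc)) [RHS]big_mkcond/=.
apply: eq_bigr => k _; case: ifPn => [/set_mem Dk|/negP Dk].
  by congr (Pr P _); apply/seteqP; split => x /= [] // ->.
rewrite (_ : _ `&` _ = set0) ?Pr0//; apply/seteqP; split => x //= [Dx xk].
by apply: Dk; rewrite -xk mem_set.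
Qed.

Lemma sum_Pr (I : finType) (c : T -> I) : mclass c ->
  \sum_k Pr P (c @^-1` [set k]) = 1.
Proof.
move=> mc; rewrite -(PrT P) (Pr_sum P mc measurableT).
by apply: eq_bigr => k _; rewrite setTI.
Qed.

Lemma same_law_perm (I : finType) (c : T -> I) (v : I -> R) (s : I -> I) :
  mclass c -> injective s ->
  (forall k, Pr P (c @^-1` [set s k]) = Pr P (c @^-1` [set k])) ->
  same_law P P (v \o c) (v \o s \o c).
Proof.
move=> mc sI Ps B mB.
have mv := mclass_preimage (v @^-1` B) mc.
have mvs := mclass_preimage ((v \o s) @^-1` B) mc.
rewrite [LHS](PrE P mv) [RHS](PrE P mvs); congr (_%:E).
rewrite (Pr_preimage (v @^-1` B) mc) (Pr_preimage ((v \o s) @^-1` B) mc).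
rewrite (reindex_inj sI)/=; apply: eq_big => [k|k _]; last exact: Ps.
by apply/idP/idP => /set_mem vB; apply/mem_set.
Qed.

(** Allows division by the mass of the class of almost every point. *)
Lemma ae_Pr_class (I : finType) (c : T -> I) : mclass c ->
  {ae P, forall w, 0 < Pr P (c @^-1` [set (c w)])}.
Proof.
move=> mc; pose D := [set k | ~ 0 < Pr P (c @^-1` [set k])].
exists (c @^-1` D); split => //; first exact: mclass_preimage.
rewrite PrE; last exact: mclass_preimage.
rewrite Pr_preimage// big1// => k /set_mem /= /negP; rewrite -leNgt => Pk.
by apply/eqP; rewrite eq_le Pk Pr_ge0.
Qed.

Lemma bmeas_integrable (Z : T -> R) S : bmeas Z -> measurable S ->
  P.-integrable S (EFin \o Z).
Proof.
move=> [mZ [K ZK]] mS; apply: measurable_bounded_integrable => //.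
- exact: le_lt_trans (probability_le1 P mS) (ltry _).
- exact: measurable_funTS.
- exists K; split; first exact: num_real.
  by move=> x Kx w _ /=; rewrite (le_trans (ZK w))// ltW.
Qed.
End FiniteClasses.

(** * Equally likely pieces sorted by the values of a bounded function *)

Section SortedPieces.
Context {R : realType} {d : measure_display} {T : measurableType d}.
Variable P : probability T R.
Hypothesis naP : nonatomic P.
Variable Z : T -> R.
Hypothesis bZ : bmeas Z.

Let mZlt x : measurable [set w | Z w < x].
Proof.
rewrite (_ : [set _ | _] = setT `&` Z @^-1` `]-oo, x[).
  by have [mZ _] := bZ; exact: mZ.
by rewrite setTI; apply/seteqP; split => w /=; rewrite in_itv.
Qed.

Let mZle x : measurable [set w | Z w <= x].
Proof.
rewrite (_ : [set _ | _] = setT `&` Z @^-1` `]-oo, x]).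
  by have [mZ _] := bZ; exact: mZ.
by rewrite setTI; apply/seteqP; split => w /=; rewrite in_itv.
Qed.

(** The number x is a quantile of [Z] on [S]: the mass of {Z < x} is at most t and that of {Z <= x}
    at least t. If the law of [Z] has an atom at x, Sierpinski's theorem cuts the level set so that
    t is hit exactly. *)
Lemma threshold_split S (a M t : R) : measurable S -> a <= M ->
  (forall w, S w -> a <= Z w <= M) -> 0 <= t <= Pr P S ->
  exists B x, [/\ measurable B, B `<=` S, Pr P B = t, a <= x <= M &
    (forall w, B w -> Z w <= x) /\ (forall w, S w -> ~ B w -> x <= Z w)].
Proof.
move=> mS aM SZ /andP[t0 tS].
pose L x := S `&` [set w | Z w < x].
have mL x : measurable (L x) by exact: measurableI.
pose E := [set x | a <= x <= M /\ Pr P (L x) <= t].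
have Ea : E a.
  split; first by rewrite lexx.
  rewrite (_ : L a = set0) ?Pr0//; apply/seteqP; split => w // [/SZ /andP[aw _] /=].
  by rewrite ltNge aw.
have hE : has_sup E by split; [exists a|exists M => x [/andP[]]].
pose x := sup E.
have ax : a <= x by exact: sup_upper_bound.
have xM : x <= M by apply: ge_sup; [exists a|move=> y [/andP[]]].
have LxE : \bigcup_n L (x - n.+1%:R^-1) = L x.
  apply/seteqP; split => [w [n _ [Sw /= wx]]|w [Sw /= wx]].
    by split => //=; rewrite (lt_le_trans wx)// gerBl.
  have /= [n] := ltr_add_invr wx; rewrite -ltrBrDr => xn.
  by exists n => //; split.
have Lxt : Pr P (L x) <= t.
  have cv : P \o (fun n => L (x - n.+1%:R^-1)) @ \oo --> P (L x).
    rewrite -LxE; apply: nondecreasing_cvg_mu => //.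
      by rewrite LxE.
    apply/nondecreasing_seqP => n; rewrite subsetEset => w [Sw /= wx].
    by split => //=; rewrite (lt_le_trans wx)// lerB// lef_pV2 ?posrE// ler_nat.
  rewrite -lee_fin -PrE//; apply: (cvge_le _ cv); apply: nearW => n /=.
  have n0 : 0 < n.+1%:R^-1 :> R by rewrite invr_gt0.
  have [y [_ Ly] xy] := sup_adherent n0 hE.
  rewrite PrE// lee_fin (le_trans _ Ly)//; apply: le_Pr => // w [Sw /= wx].
  by split => //=; rewrite (lt_trans wx).
pose V := S `&` [set w | Z w <= x].
have mV : measurable V by exact: measurableI.
have VE : \bigcap_n L (x + n.+1%:R^-1) = V.
  apply/seteqP; split => [w LV|w [Sw /= wx] n _].
    have [Sw _] := LV 0%N I; split => //=; rewrite leNgt; apply/negP => xw.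
    have [n xn] := ltr_add_invr xw; have [_ /=] := LV n I.
    by rewrite ltNge ltW.
  by split => //=; rewrite (le_lt_trans wx)// ltrDl invr_gt0.
have tV : t <= Pr P V.
  have cv : P \o (fun n => L (x + n.+1%:R^-1)) @ \oo --> P V.
    rewrite -VE; apply: nonincreasing_cvg_mu => //.
    - exact: le_lt_trans (probability_le1 P (mL _)) (ltry _).
    - by rewrite VE.
    - apply/nonincreasing_seqP => n; rewrite subsetEset => w [Sw /= wx].
      by split => //=; rewrite (lt_le_trans wx)// lerD2l lef_pV2 ?posrE// ler_nat.
  rewrite -lee_fin -PrE//; apply: (cvge_ge _ cv); apply: nearW => n /=.
  have n0 : 0 < n.+1%:R^-1 :> R by rewrite invr_gt0.
  (* Below M, a mass smaller than t would put x + 1/(n+1) into [E], above its supremum; beyond M,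
     the sublevel set is all of [S]. *)
  rewrite PrE// lee_fin; have [xnM|Mxn] := leP (x + n.+1%:R^-1) M.
    rewrite leNgt; apply/negP => Lt.
    have : E (x + n.+1%:R^-1) by split; [rewrite xnM andbT (le_trans ax)// lerDl
      ltW|exact: ltW].
    by move/(sup_upper_bound hE); rewrite -/x leNgt ltrDl n0.
  rewrite (le_trans tS)//; apply: le_Pr => // w Sw; split => //=.
  by have /andP[_ /le_lt_trans->] := SZ _ Sw.
have LV : L x `<=` V by move=> w [Sw /ltW wx]; split.
have [||C [mC CV PC]] := @sierpinski _ _ _ P naP (V `\` L x) (t - Pr P (L x)).
- exact: measurableD.
- by rewrite PrD//; lra.
exists (L x `|` C), x; split.
- exact: measurableU.
- by move=> w [[]//|/CV[[]]].
- rewrite PrU//; first by rewrite PC; ring.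
  by apply/seteqP; split => w // [? /CV[]].
- by rewrite ax xM.
- split => [w [[_ /ltW//]|/CV[[]//]]|w Sw /not_orP[Lw _]].
  by rewrite leNgt; apply/negP => wx; apply: Lw.
Qed.

(* Cutting [S] from the lowest values of [Z] upwards, the upper bound on a piece
   is a lower bound on the next one, so the Darboux sum telescopes. *)
Lemma sorted_pieces n S (a M h : R) : measurable S -> a <= M -> 0 <= h ->
  (forall w, S w -> a <= Z w <= M) -> Pr P S = n.+1%:R * h ->
  exists (f : T -> nat) (x : nat -> R),
    [/\ forall w, (f w <= n)%N,
      forall i, (i <= n)%N -> measurable (S `&` f @^-1` [set i]) /\
        Pr P (S `&` f @^-1` [set i]) = h,
      forall w, S w -> Z w <= x (f w) &
      h * (\sum_(i < n.+1) x i) <= \int[P]_(w in S) Z w + (M - a) * h].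
Proof.
move=> + + h0; elim: n S a => [|n IH] S a mS aM SZ PS.
  (* The last piece has only the crude upper bound M, at the cost (M - a) h. *)
  exists (fun=> 0%N), (fun=> M); split => //.
  - move=> i; rewrite leqn0 => /eqP ->.
    rewrite (_ : _ `&` _ = S); last by apply/seteqP; split => // w [].
    by split => //; rewrite PS mul1r.
  - by move=> w /SZ/andP[].
  - rewrite big_ord1.
    have : \int[P]_(w in S) a <= \int[P]_(w in S) Z w.
      apply: le_Rintegral => //.
      + exact: finite_measure_integrable_cst.
      + exact: bmeas_integrable.
      + by move=> w /SZ/andP[].
    by rewrite Rintegral_cst// -/(Pr P S) PS mul1r; lra.
have [|B [x0 [mB BS PB /andP[ax xM] [Bx xB]]]] := @threshold_split S a M h mS aM SZ.
  rewrite h0 PS /= -addn1 natrD mulrDl mul1r lerDr mulr_ge0//.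
have [||w [Sw Bw]||f [x [fn fP fx hx]]] := IH (S `\` B) x0.
- exact: measurableD.
- exact: xM.
- by rewrite xB//=; have /andP[] := SZ w Sw.
- by rewrite PrD// PB PS -addn1 natrD; ring.
exists (fun w => if w \in B then 0%N else (f w).+1),
  (fun i => if i is i'.+1 then x i' else x0); split.
- by move=> w; case: ifP => // _; exact: fn.
- case => [_|i ni].
    rewrite (_ : _ `&` _ = B)//; apply/seteqP; split => w /=.
      by case; case: ifPn => [/set_mem|].
    by move=> Bw; split; [exact: BS|rewrite mem_set].
  rewrite (_ : _ `&` _ = (S `\` B) `&` f @^-1` [set i]); first exact: fP.
  apply/seteqP; split => w /=.
    by case: ifPn => [_ []//|/negP Bw [Sw [fw]]]; split => //; split => // /mem_set.
  by move=> [[Sw Bw] fw]; case: ifPn => [/set_mem//|_]; rewrite fw.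
- move=> w Sw; case: ifPn => [/set_mem/Bx//|/negP Bw].
  by apply: fx; split => // /mem_set.
- rewrite big_ord_recl/= mulrDr.
  have -> : \int[P]_(w in S) Z w = \int[P]_(w in B) Z w + \int[P]_(w in S `\` B) Z w.
    rewrite -Rintegral_setU//.
    + by rewrite setDUK.
    + exact: measurableD.
    + by rewrite setDUK//; exact: bmeas_integrable.
    + by apply/disj_set2P; apply/seteqP; split => // w [? []].
  have : \int[P]_(w in B) a <= \int[P]_(w in B) Z w.
    apply: le_Rintegral => //.
    + exact: finite_measure_integrable_cst.
    + exact: bmeas_integrable.
    + by move=> w /BS/SZ/andP[].
  by rewrite Rintegral_cst// -/(Pr P B) PB; lra.
Qed.
End SortedPieces.

(** * Law-invariant risk measures and conditional expectation *)

Section Acceptance.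
Context {R : realType} {d : measure_display} {T : measurableType d}.
Variables (P : probability T R) (A : set (T -> R)).
Hypothesis AS : acceptance_set P A.
Implicit Types X Y Z : T -> R.

Lemma bmeas_Linf X : bmeas X -> Linf P X.
Proof. by move=> [mX [K XK]]; split => //; exists K; exact: aeW. Qed.

Lemma LinfD X Y : Linf P X -> Linf P Y -> Linf P (fun w => X w + Y w).
Proof.
move=> [mX [K XK]] [mY [L YL]]; split; first exact: measurable_funD.
exists (K + L); apply: filterS2 XK YL => w XK YL.
by rewrite (le_trans (ler_normD _ _))// lerD.
Qed.

Lemma LinfZ (a : R) X : Linf P X -> Linf P (fun w => a * X w).
Proof.
move=> [mX [K XK]]; split; first exact: measurable_funM.
by exists (`|a| * K); apply: filterS XK => w XK; rewrite normrM ler_wpM2l.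
Qed.

Lemma Linf_cst (a : R) : Linf P (fun=> a).
Proof. by split; [exact: measurable_cst|exists `|a|; exact: aeW]. Qed.

Lemma LinfB X Y : Linf P X -> Linf P Y -> Linf P (fun w => X w - Y w).
Proof.
move=> LX LY; have := LinfD LX (LinfZ (-1) LY).
by under eq_fun do rewrite mulN1r.
Qed.

Lemma acc_mono X Y : A X -> Linf P Y -> {ae P, forall w, X w <= Y w} -> A Y.
Proof.
move=> AX LY XY; have [AL _ _ up] := AS.
have := up X (fun w => Y w - X w) AX (LinfB LY (AL _ AX)).
rewrite (_ : _ \+ _ = Y); last by apply/funext => w /=; rewrite addrC subrK.
by apply; apply: filterS XY => w; rewrite subr_ge0.
Qed.

Lemma acc_shift_ex X : Linf P X -> exists m, A (fun w => X w + m).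
Proof.
move=> LX; have [AL [Z AZ] _ _] := AS.
have [_ [K XK]] := LX; have [_ [L ZL]] := AL _ AZ.
exists (K + L); apply: (acc_mono AZ); first exact: LinfD LX (Linf_cst _).
by apply: filterS2 XK ZL => w; rewrite !ler_norml; lra.
Qed.

Lemma acc_shift_lb X : Linf P X ->
  exists b, forall m, A (fun w => X w + m) -> b <= m.
Proof.
move=> LX; have [AL _ [W [LW nAW]] _] := AS.
have [_ [K XK]] := LX; have [_ [L WL]] := LW.
exists (- (K + L)) => m Am; rewrite leNgt; apply/negP => mlt; apply: nAW.
apply: (acc_mono Am) => //.
by apply: filterS2 XK WL => w; rewrite !ler_norml; lra.
Qed.

Local Notation rho := (rho A).

Lemma rho_le X m : Linf P X -> A (fun w => X w + m) -> rho X <= m.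
Proof.
move=> LX Am; have [b bm] := acc_shift_lb LX.
by apply: ge_inf => //; exists b => x /bm.
Qed.

(** The inequality is strict because the infimum defining [rho] may not be attained. *)
Lemma acc_rho X m : Linf P X -> rho X < m -> A (fun w => X w + m).
Proof.
move=> LX rm; have [m0 Am0] := acc_shift_ex LX.
have [||x /= Ax xm] := @inf_adherent R [set m | A (fun w => X w + m)] (m - rho X).
- by rewrite subr_gt0.
- by split; [exists m0|have [b bm] := acc_shift_lb LX; exists b => x /bm].
apply: (acc_mono Ax); first exact: LinfD LX (Linf_cst _).
apply: aeW => w; rewrite lerD2l ltW// (lt_le_trans xm)//.
by rewrite /rho addrC subrK.
Qed.

(** Monotonicity and cash additivity in one statement; with a uniform bound on X - Y it is the
    sup-norm Lipschitz estimate. *)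
Lemma rho_shift_le X Y a : Linf P X -> Linf P Y ->
  {ae P, forall w, X w <= Y w + a} -> rho Y <= rho X + a.
Proof.
move=> LX LY XY; apply/ler_addgt0Pr => e e0.
apply: rho_le => //; apply: (acc_mono (@acc_rho X (rho X + e) LX _)).
- by rewrite ltrDl.
- exact: LinfD LY (Linf_cst _).
- by apply: filterS XY => w; lra.
Qed.

Hypothesis CV : convex_acc A.

Lemma rho_convex X Y l : Linf P X -> Linf P Y -> 0 <= l <= 1 ->
  rho (fun w => l * X w + (1 - l) * Y w) <= l * rho X + (1 - l) * rho Y.
Proof.
move=> LX LY l01; apply/ler_addgt0Pr => e e0.
apply: rho_le; first by apply: LinfD; exact: LinfZ.
have AX : A (fun w => X w + (rho X + e)) by apply: acc_rho => //; rewrite ltrDl.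
have AY : A (fun w => Y w + (rho Y + e)) by apply: acc_rho => //; rewrite ltrDl.
have := CV AX AY l01; congr (A _); apply/funext => w; ring.
Qed.

Lemma acc_mean n (Y : nat -> T -> R) : (forall i, (i <= n)%N -> A (Y i)) ->
  A (fun w => n.+1%:R^-1 * \sum_(i < n.+1) Y i w).
Proof.
elim: n => [|n IH] AY.
  have -> : (fun w => 1%:R^-1 * \sum_(i < 1) Y i w) = Y 0%N.
    by apply/funext => w; rewrite big_ord1 invr1 mul1r.
  exact: AY.
have AYn : A (fun w => n.+1%:R^-1 * \sum_(i < n.+1) Y i w).
  by apply: IH => i /leqW; exact: AY.
have n1 : n.+2%:R != 0 :> R by rewrite pnatr_eq0.
have n2 : n.+1%:R != 0 :> R by rewrite pnatr_eq0.
have := CV AYn (AY n.+1 (leqnn _)) (_ : 0 <= n.+1%:R / n.+2%:R <= 1).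
rewrite divr_ge0//= ler_pdivrMr// mul1r ler_nat leqnSn => /(_ isT).
congr (A _); apply/funext => w; rewrite [in RHS]big_ord_recr/= mulrA.
rewrite -(mulrA _ _ (n.+1%:R^-1)) (mulrC _ n.+1%:R^-1) mulrA mulfV// mul1r mulrDr.
congr (_ + _ * _); have gen (x : R) : x + 1 != 0 -> 1 - x / (x + 1) = (x + 1)^-1 by
  move=> ?; field.
by rewrite -[n.+2%:R]natr1 gen ?natr1.
Qed.

Hypothesis LI : law_invariant P A.

Lemma rho_same_law X Y : Linf P X -> Linf P Y -> same_law P P X Y ->
  rho X = rho Y.
Proof.
move=> LX LY XY; congr (inf _); apply/seteqP.
have shift (B : set R) m : measurable B -> measurable [set x | B (x + m)].
  move=> mB; rewrite (_ : [set _ | _] = setT `&` (+%R^~ m) @^-1` B) ?setTI//.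
  by rewrite -[X in measurable X]setTI; apply: measurable_funD.
split => m /= Am.
- apply: LI Am _ _; first exact: LinfD LY (Linf_cst _).
  by move=> B mB; exact: (XY [set x | B (x + m)] (shift _ _ mB)).
- apply: LI Am _ _; first exact: LinfD LX (Linf_cst _).
  by move=> B mB; exact/esym/(XY [set x | B (x + m)] (shift _ _ mB)).
Qed.

Hypothesis naP : nonatomic P.

(* A rearrangement [g 0 >= Z] that is constant on [n.+1] equally likely pieces of
   each class has the same law as its cyclic shifts [g s], and the mean of these
   shifts is, up to O(1/n), the conditional expectation of [Z]. *)
Lemma acc_cond_mean (I : finType) (c : T -> I) (v : I -> R) Z (m eta e : R) :
  mclass c -> bmeas Z ->
  (forall k, \int[P]_(w in c @^-1` [set k]) Z w <=
     (v k + eta) * Pr P (c @^-1` [set k])) ->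
  eta < e -> A (fun w => Z w + m) -> A (fun w => v (c w) + (m + e)).
Proof.
move=> mc bZ Zv etae AZ; have [mZ [K ZK]] := bZ.
have K0 : 0 <= K by exact: le_trans (normr_ge0 _) (ZK point).
(* Since [Z] ranges over an interval of length 2 K, the sorted pieces err by 2 K / (n+1) relative to
   the mass of a class. *)
have [n nP] : exists n, 2 * K / n.+1%:R <= e - eta.
  have e0 : 0 < e - eta by rewrite subr_gt0.
  have Q0 : 0 <= 2 * K / (e - eta) by rewrite divr_ge0 ?mulr_ge0// ltW.
  exists (Num.bound (2 * K / (e - eta))).
  rewrite ler_pdivrMr// (mulrC (e - eta)) -ler_pdivrMr// (le_trans (ltW (archi_boundP
    Q0)))//.
  by rewrite ler_nat.
pose h k := Pr P (c @^-1` [set k]) / n.+1%:R.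
have h0 k : 0 <= h k by rewrite divr_ge0 ?Pr_ge0.
have hP k : Pr P (c @^-1` [set k]) = n.+1%:R * h k.
  by rewrite mulrC divfK// pnatr_eq0.
have /choice[fx fxP] : forall k, exists fx : (T -> nat) * (nat -> R),
    [/\ forall w, (fx.1 w <= n)%N,
      forall i, (i <= n)%N -> measurable (c @^-1` [set k] `&` fx.1 @^-1` [set i]) /\
        Pr P (c @^-1` [set k] `&` fx.1 @^-1` [set i]) = h k,
      forall w, c w = k -> Z w <= fx.2 (fx.1 w) &
      h k * (\sum_(i < n.+1) fx.2 i) <=
        \int[P]_(w in c @^-1` [set k]) Z w + 2 * K * h k].
  move=> k; have [|w _|f [x [f1 f2 f3 f4]]] :=
      @sorted_pieces _ _ _ P naP Z bZ n _ (- K) K _ (mc k) _ (h0 k) _ (hP k).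
  - by rewrite (le_trans (_ : _ <= 0))// oppr_le0.
  - by rewrite -ler_norml.
  - by exists (f, x); split => //=; rewrite (le_trans f4)// lerD2l; lra.
pose f (w : T) : 'I_n.+1 := inord ((fx (c w)).1 w).
pose b (w : T) := (c w, f w).
have fE w : f w = (fx (c w)).1 w :> nat.
  by rewrite /f inordK// ltnS; have [] := fxP (c w).
have bE k i : b @^-1` [set (k, i)] = c @^-1` [set k] `&` (fx k).1 @^-1` [set (i : nat)].
  apply/seteqP; split => w /=.
    by move=> [<- <-]; rewrite fE.
  by move=> [<- fi]; congr pair; apply: val_inj; rewrite /= fE.
have mb : mclass b.
  move=> [k i]; rewrite bE; have [_ + _ _] := fxP k.
  by move=> /(_ i (ltnSE (ltn_ord i)))[].
have Pb k i : Pr P (b @^-1` [set (k, i)]) = h k.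
  by rewrite bE; have [_ + _ _] := fxP k; move=> /(_ i (ltnSE (ltn_ord i)))[].
pose u (j : I * 'I_n.+1) := (fx j.1).2 j.2 + m.
(* Addition in ['I_n.+1] is modulo n+1, so [s t] permutes the pieces of each class cyclically. *)
pose s (t : 'I_n.+1) (j : I * 'I_n.+1) := (j.1, j.2 + t).
pose g t := u \o s t \o b.
have Lg t : Linf P (g t) by apply: bmeas_Linf; exact: (mclass_bmeas (u \o s t) mb).
have Lu : Linf P (u \o b) by apply: bmeas_Linf; exact: mclass_bmeas.
have Au : A (u \o b).
  apply: (acc_mono AZ) => //; apply: aeW => w /=; rewrite /u /= lerD2r fE.
  by have [_ _ + _] := fxP (c w); apply.
have Ag t : A (g t).
  apply: (LI Au (Lg t)); apply: same_law_perm => //.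
    move=> [k i] [k' i'] ee; have /= -> := congr1 fst ee.
    by have /= /addIr -> := congr1 snd ee.
  by move=> [k i]; rewrite !Pb.
have := @acc_mean n (fun i => g (inord i)) (fun i _ => Ag _).
move/acc_mono; apply.
  exact: LinfD (bmeas_Linf (mclass_bmeas v mc)) (Linf_cst _).
apply: filterS (ae_Pr_class P mc) => w Pw.
(* The shifts together visit every piece of the class of w once, so their mean is constant on the
   class. *)
have -> : \sum_(i < n.+1) g (inord i) w = \sum_(i < n.+1) (fx (c w)).2 i + n.+1%:R * m.
  under eq_bigr => i _ do rewrite inord_val /g /u /=.
  rewrite big_split/= sumr_const card_ord mulr_natl; congr (_ + _).
  by rewrite [RHS](reindex_inj (addrI (f w))).
have [_ _ _] := fxP (c w); have := Zv (c w).
set q := \int[P]_(_ in _) _; set x := \sum_(i < _) _; rewrite hP.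
have hw : 0 < h (c w) by rewrite divr_gt0.
have n0 : 0 < n.+1%:R :> R by rewrite ltr0n.
move=> q1 q2.
rewrite ler_pdivrMl//.
have : h (c w) * x <= h (c w) * (n.+1%:R * (v (c w) + eta) + 2 * K) by nra.
rewrite ler_pM2l//; move: nP; rewrite ler_pdivrMr//; nra.
Qed.

(** The hypothesis says that v + eta dominates the conditional expectation of [Z]; written with
    integrals, it holds trivially on null classes. *)
Lemma rho_cond_mean (I : finType) (c : T -> I) (v : I -> R) Z (eta : R) :
  mclass c -> bmeas Z ->
  (forall k, \int[P]_(w in c @^-1` [set k]) Z w <=
     (v k + eta) * Pr P (c @^-1` [set k])) ->
  rho (v \o c) <= rho Z + eta.
Proof.
move=> mc bZ Zv; apply/ler_addgt0Pr => e e0.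
have LZ := bmeas_Linf bZ.
have -> : rho Z + eta + e = (rho Z + e / 2) + (eta + e / 2) by lra.
apply: rho_le; first exact/bmeas_Linf/mclass_bmeas.
apply: (acc_cond_mean mc bZ Zv); first by lra.
by apply: acc_rho => //; lra.
Qed.
End Acceptance.

(** * Couplings and grids *)

Section Coupling.
Context {R : realType} {d : measure_display} {T : measurableType d}.
Variable P : probability T R.
Hypothesis naP : nonatomic P.

Let eq0_sum (I : finType) (F : I -> R) : (forall i, 0 <= F i) -> \sum_i F i = 0 ->
  forall i, F i = 0.
Proof. by move=> F0 /eqP; rewrite psumr_eq0// => /allP F0' i; apply/eqP/F0'; rewrite
  mem_index_enum. Qed.

(* [m j = min (p j) (q j)] is the mass that can be matched inside class [j]; the
   weights [w j i] match it proportionally and couple the rest independently. *)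
Lemma coupling (I J : finType) (i0 : I) (c : T -> J) (u : I -> R) (r : I -> J) :
  mclass c -> (forall i, 0 <= u i) -> \sum_i u i = 1 ->
  exists f : T -> I, [/\ mclass f, forall i, Pr P (f @^-1` [set i]) = u i &
    Pr P [set w | r (f w) <> c w] <=
      \sum_j `|Pr P (c @^-1` [set j]) - \sum_(i | r i == j) u i|].
Proof.
move=> mc u0 u1.
pose p j := Pr P (c @^-1` [set j]).
pose q j := \sum_(i | r i == j) u i.
have p0 j : 0 <= p j by exact: Pr_ge0.
have p1 : \sum_j p j = 1 by exact: sum_Pr.
have q0 j : 0 <= q j by exact: sumr_ge0.
pose m j := Num.min (p j) (q j).
have m0 j : 0 <= m j by rewrite le_min p0 q0.
have mp j : m j <= p j by rewrite ge_min lexx.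
have mq j : m j <= q j by rewrite ge_min lexx orbT.
pose t j := m j / q j.
have t0 j : 0 <= t j by rewrite divr_ge0.
have t1 j : t j <= 1.
  have [qj|qj] := ltP 0 (q j); first by rewrite ler_pdivrMr// mul1r.
  have /eqP qj0 : q j == 0 by rewrite eq_le qj q0.
  by rewrite /t qj0 invr0 mulr0.
have qt j : q j * t j = m j.
  have [qj|qj] := ltP 0 (q j); first by rewrite mulrC divfK// gt_eqF.
  have /eqP qj0 : q j == 0 by rewrite eq_le qj q0.
  by rewrite qj0 mul0r; apply/eqP; rewrite eq_le m0 -qj0 mq.
pose D := \sum_j m j.
have sumut : \sum_i u i * t (r i) = D.
  rewrite (partition_big r predT)//=; apply: eq_bigr => j _.
  rewrite -qt mulr_suml; apply: eq_bigr => i /eqP -> //.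
have sumpm : \sum_j (p j - m j) = 1 - D by rewrite sumrB p1.
have sumun : \sum_i u i * (1 - t (r i)) = 1 - D.
  by rewrite -sumut -[X in _ = X - _]u1 -sumrB; apply: eq_bigr => i _; rewrite mulrBr mulr1.
have pm0 j : 0 <= p j - m j by rewrite subr_ge0.
have un0 i : 0 <= u i * (1 - t (r i)) by rewrite mulr_ge0// subr_ge0.
have D1 : 0 <= 1 - D by rewrite -sumpm sumr_ge0.
pose w j i := (r i == j)%:R * (u i * t j) +
  (p j - m j) * (u i * (1 - t (r i))) / (1 - D).
have w0 j i : 0 <= w j i.
  apply: addr_ge0; first exact: mulr_ge0 (ler0n _ _) (mulr_ge0 (u0 i) (t0 j)).
  exact: divr_ge0 (mulr_ge0 (pm0 j) (un0 i)) D1.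
have wrow j : \sum_i w j i = p j.
  rewrite big_split/= -(eq_bigr _ (fun i _ => mulrA _ _ _)) -mulr_sumr -mulr_suml sumun.
  have -> : \sum_i (r i == j)%:R * (u i * t j) = m j.
    rewrite -qt mulr_suml [RHS]big_mkcond/=; apply: eq_bigr => i _.
    by case: ifP; rewrite ?mul1r ?mul0r.
  (* When everything is matched, the leftover masses vanish, and the quotient by zero is 0 as it
     should be. The same happens for the columns. *)
  have [D0|/eqP D0] := eqVneq (1 - D) 0; last by rewrite mulfV ?mulr1 ?subrKC//; apply/eqP.
  by have := eq0_sum pm0 (etrans sumpm D0) j; rewrite D0 mul0r mulr0 addr0; lra.
have wcol i : \sum_j w j i = u i.
  rewrite big_split/= -mulr_suml -mulr_suml sumpm.
  have -> : \sum_j (r i == j)%:R * (u i * t j) = u i * t (r i).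
    rewrite (bigD1 (r i))//= eqxx mul1r big1 ?addr0// => j /negbTE.
    by rewrite eq_sym => ->; rewrite mul0r.
  have [D0|/eqP D0] := eqVneq (1 - D) 0.
    have := eq0_sum un0 (etrans sumun D0) i; rewrite D0 !mul0r addr0; lra.
  by rewrite mulrAC mulfV ?mul1r//; [lra|exact/eqP].
have /choice[f fP] : forall j, exists f : T -> I, forall i,
    measurable (c @^-1` [set j] `&` f @^-1` [set i]) /\
    Pr P (c @^-1` [set j] `&` f @^-1` [set i]) = w j i.
  by move=> j; apply: split_weights.
pose g x := f (c x) x.
have gE j i : g @^-1` [set i] `&` c @^-1` [set j] = c @^-1` [set j] `&` f j @^-1` [set i].
  by apply/seteqP; split => x /= []; rewrite /g => ? ?; split => //; subst.
have mg : mclass g.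
  move=> i; rewrite (_ : _ @^-1` _ = \bigcup_j (c @^-1` [set j] `&` f j @^-1` [set i])).
    by apply: fin_bigcup_measurable => [|j _]; [exact: finite_finset|have [] := fP j i].
  apply/seteqP; split => [x gx|x [j _ []]]; first by exists (c x).
  by rewrite /g /= => ->.
have Pg i : Pr P (g @^-1` [set i]) = u i.
  rewrite (Pr_sum P mc (mg i)) -wcol; apply: eq_bigr => j _.
  by rewrite gE; have [] := fP j i.
exists g; split => //.
have mS : measurable [set x | r (g x) = c x].
  exact: (mclass_preimage [set ij | r ij.1 = ij.2] (mclass_pair mg mc)).
rewrite (_ : [set _ | _] = ~` [set x | r (g x) = c x]); last first.
  by apply/seteqP; split => x.
(* The matched mass is at least [D], and 1 - D is the sum of the excesses p j - m j, each at most |p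
   j - q j|. *)
rewrite PrC// (le_trans (_ : _ <= 1 - D))//; last first.
  rewrite -sumpm ler_sum// => j _; rewrite -/(p j) -/(q j) /m.
  by case: (leP (p j) (q j)) => _; [rewrite subrr normr_ge0|exact: ler_norm].
rewrite lerD2l lerN2 (Pr_sum P mg mS) -sumut ler_sum// => i _.
rewrite (_ : _ `&` _ = g @^-1` [set i] `&` c @^-1` [set (r i)]).
  rewrite gE; have [_ ->] := fP (r i) i.
  by rewrite /w eqxx mul1r lerDl; exact: divr_ge0 (mulr_ge0 (pm0 _) (un0 i)) D1.
by apply/seteqP; split => x /= [a b]; split => //; subst.
Qed.
End Coupling.

(** Names the cell of x by its comparisons with all thresholds, which gives a finite label type
    without sorting them. *)
Definition bits {R : realType} (K : nat) (a : 'I_K -> R) (x : R) : {ffun 'I_K -> bool} :=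
  [ffun j => a j <= x].

(** The points whose cell may change under a perturbation smaller than e. When their mass is small,
    Prohorov closeness controls the masses of the cells. *)
Definition near_thresholds {R : realType} (K : nat) (a : 'I_K -> R) (e : R) : set R :=
  [set x | exists j, `|x - a j| < e].

Section Grid.
Context {R : realType}.
Implicit Types (mu nu : probability R R).

Lemma bits_mclass {d} {T : measurableType d} (X : T -> R) K (a : 'I_K -> R) :
  measurable_fun setT X -> mclass (bits a \o X).
Proof.
move=> mX k; pose F j := X @^-1` [set x | (a j <= x) = k j].
rewrite (_ : _ @^-1` _ = \bigcap_j F j).
  apply: fin_bigcap_measurable => [|j _]; first exact: finite_finset.
  rewrite -[F j]setTI; apply: mX => //.
  case: (k j).
    rewrite (_ : [set _ | _] = `[a j, +oo[%classic)//.
    by apply/seteqP; split => x /=; rewrite in_itv/= andbT.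
  rewrite (_ : [set _ | _] = `]-oo, a j[%classic)//.
  by apply/seteqP; split => x /=; rewrite in_itv/= ltNge; [move=> ->|move/negbTE].
apply/seteqP; split => x /= Xk.
  by move=> j _; rewrite /F /= -Xk ffunE.
by apply/ffunP => j; rewrite ffunE; exact: Xk.
Qed.

Lemma bits_near K (a : 'I_K -> R) e x y : `|x - y| < e ->
  ~ near_thresholds a e x -> bits a x = bits a y.
Proof.
move=> xy nx; apply/ffunP => j; rewrite !ffunE.
have {}nx : e <= `|x - a j| by rewrite leNgt; apply/negP => h; apply: nx; exists j.
move: xy nx; rewrite ltr_norml ler_normr => /andP[? ?] /orP nx.
by apply/idP/idP => ?; case: nx => ?; lra.
Qed.

Lemma measurable_near K (a : 'I_K -> R) e : measurable (near_thresholds a e).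
Proof.
rewrite (_ : near_thresholds a e = \bigcup_j `](a j - e), (a j + e)[%classic).
  by apply: fin_bigcup_measurable => //; exact: finite_finset.
apply/seteqP; split => [x [j]|x [j _]].
  by rewrite ltr_distl => xj; exists j => //=; rewrite in_itv.
by rewrite /= in_itv/= => xj; exists j; rewrite ltr_distl.
Qed.

(* Among the [N] shifts by [r * eta / N] of a grid of mesh [eta], the
   neighbourhoods of radius [eta / (2 * N)] are disjoint: one of them has mass at
   most [1 / N]. *)
Lemma good_grid mu (M eta : R) : 0 <= M -> 0 < eta ->
  exists K, forall th, 0 < th -> exists (a : 'I_K -> R) e, [/\ 0 < e,
    forall x y, `|x| <= M -> bits a x = bits a y -> `|x - y| <= eta &
    Pr mu (near_thresholds a e) <= th].
Proof.
move=> M0 eta0.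
pose K := (Num.truncn ((2 * M + 2 * eta) / eta)).+1.
(* [K] is fixed before [th], which will later depend on the number of cells. *)
exists K => th th0.
pose N := (Num.bound th^-1).+1.
have N0 : 0 < N%:R :> R by rewrite ltr0n.
have NthP : 1 < N%:R * th.
  rewrite -ltr_pdivrMr// mul1r (lt_trans (archi_boundP _)) ?invr_ge0 ?ltW//.
  by rewrite ltr_nat.
pose h := eta / N%:R.
have h0 : 0 < h by rewrite divr_gt0.
have hN : N%:R * h = eta by rewrite mulrC divfK// gt_eqF.
pose a (r : 'I_N) (j : 'I_K) := - M - eta + (N * j + r)%:R * h.
have disj (r r' : 'I_N) : r != r' ->
    near_thresholds (a r) (h / 2) `&` near_thresholds (a r') (h / 2) = set0.
  move=> rr'; apply/seteqP; split => // x [[j xj] [j' xj']].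
  (* Two thresholds within h / 2 of the same point are less than h apart; lying on one lattice of
     mesh h, they coincide. *)
  have lt_case (n n' : nat) : `|x - (- M - eta + n%:R * h)| < h / 2 ->
      `|x - (- M - eta + n'%:R * h)| < h / 2 -> (n <= n')%N.
    move=> xn xn'; rewrite -ltnS -(ltr_nat R) -natr1 -(ltr_pM2r h0) mulrDl mul1r.
    by move: xn xn'; rewrite !ltr_norml; lra.
  have nn : (N * j + r = N * j' + r')%N by apply/eqP; rewrite eqn_leq !lt_case.
  move/eqP: rr'; apply; apply: val_inj => /=.
  by rewrite -(modn_small (ltn_ord r)) -(modn_small (ltn_ord r')) -(modnMDl j) -(modnMDl
    j' r') !(mulnC _ N) nn.
have [r rP] : exists r, Pr mu (near_thresholds (a r) (h / 2)) <= th.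
  apply: contrapT => /forallNP nr.
  have : \sum_r Pr mu (near_thresholds (a r) (h / 2)) <= 1.
    rewrite -Pr_bigcup//; last by move=> ?; exact: measurable_near.
    apply: Pr_le1; apply: fin_bigcup_measurable => [|? _]; first exact: finite_finset.
    exact: measurable_near.
  apply/negP; rewrite -ltNge (lt_le_trans NthP)//.
  rewrite -[N in N%:R](card_ord N) mulr_natl -sumr_const ler_sum// => r _.
  by rewrite ltW// ltNge; apply/negP/nr.
exists (a r), (h / 2); split => //; first by rewrite divr_gt0.
(* A threshold in (z, z + eta], for z = x or z = x - eta, separates x from any y farther away than
   eta. Thus only x has to be bounded by M. *)
have grid z : - M - eta <= z <= M -> exists j, z < a r j <= z + eta.
  move=> /andP[zl zu].
  have rN : r%:R * h <= eta.
    by rewrite -hN ler_pM2r// ler_nat ltnW.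
  pose s := (z + M + 2 * eta - r%:R * h) / eta.
  have s0 : 0 <= s by apply: divr_ge0; [lra|exact: ltW].
  have sE : s * eta = z + M + 2 * eta - r%:R * h by rewrite divfK// gt_eqF.
  have := truncn_itv s0 => /andP[js sj].
  have jK : (Num.truncn s < K)%N.
    rewrite ltnS; apply: le_truncn; rewrite ler_pdivrMr// divfK ?gt_eqF//.
    have : 0 <= r%:R * h by rewrite mulr_ge0// ltW.
    lra.
  exists (Ordinal jK); rewrite /a /= natrD natrM mulrDl mulrAC hN.
  move: js sj; rewrite -(ler_pM2r eta0) -(ltr_pM2r eta0) sE -natr1 mulrDl mul1r.
  by move=> js sj; apply/andP; split; lra.
move=> x y; rewrite ler_norml => xM /ffunP xy.
rewrite ler_norml; apply/andP; split; rewrite leNgt; apply/negP => lt.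
- have [|j jP] := grid x; first by lra.
  by have := xy j; rewrite !ffunE; move: jP => /andP[? ?]; case: leP; case: leP => //; lra.
- have [|j jP] := grid (x - eta); first by lra.
  by have := xy j; rewrite !ffunE; move: jP => /andP[? ?]; case: leP; case: leP => //; lra.
Qed.
End Grid.

(** * Moments *)

Section Law.
Context {R : realType} {d : measure_display} {T : measurableType d}.
Variable P : probability T R.

Definition law (X : T -> R) (mX : measurable_fun setT X) : probability R R :=
  distribution P (HB.pack_for {mfun T >-> R} X (isMeasurableFun.Build _ _ _ _ X mX)).

Lemma lawE X (mX : measurable_fun setT X) B : law mX B = P (X @^-1` B).
Proof. by []. Qed.

Lemma ge0_integral_law (nu : probability R R) (X : T -> R) (D : set R)
    (f : R -> \bar R) :
  measurable_fun setT X -> (forall B, measurable B -> P (X @^-1` B) = nu B) ->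
  measurable D -> measurable_fun D f -> (forall y, (0 <= f y)%E) ->
  (\int[nu]_(y in D) f y = \int[P]_(w in X @^-1` D) f (X w))%E.
Proof.
move=> mX XE mD mf f0.
rewrite (@eq_measure_integral _ _ _ D (law mX)); last first.
  by move=> B mB _; exact/esym/XE.
by rewrite (ge0_integral_pushforward mX).
Qed.
End Law.

Section Moments.
Context {R : realType} {d : measure_display} {T : measurableType d}.
Variable P : probability T R.
Implicit Types X Y : T -> R.

Lemma le_integral_EFin S (f g : T -> R) : measurable S ->
  measurable_fun setT f -> measurable_fun setT g ->
  (forall w, 0 <= f w) -> (forall w, f w <= g w) ->
  (\int[P]_(w in S) (f w)%:E <= \int[P]_(w in S) (g w)%:E)%E.
Proof.
move=> mS mf mg f0 fg.
apply: (ge0_le_integral P mS) => [w _|||w _]; rewrite ?lee_fin//;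
  exact/measurable_EFinP/measurable_funTS.
Qed.

Lemma integral_lin S (a b : R) (f g : T -> R) : measurable S ->
  measurable_fun setT f -> measurable_fun setT g ->
  (forall w, 0 <= f w) -> (forall w, 0 <= g w) -> 0 <= a -> 0 <= b ->
  (\int[P]_(w in S) (a * f w + b * g w)%:E =
   a%:E * \int[P]_(w in S) (f w)%:E + b%:E * \int[P]_(w in S) (g w)%:E)%E.
Proof.
move=> mS mf mg f0 g0 a0 b0.
have mfE : measurable_fun S (fun w => (f w)%:E).
  exact/measurable_EFinP/measurable_funTS.
have mgE : measurable_fun S (fun w => (g w)%:E).
  exact/measurable_EFinP/measurable_funTS.
rewrite -(ge0_integralZl P mS mfE) => [|w _|]; rewrite ?lee_fin//.
rewrite -(ge0_integralZl P mS mgE) => [|w _|]; rewrite ?lee_fin//.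
rewrite -(ge0_integralD P mS) => [//|w _||w _|].
- by rewrite -EFinM lee_fin mulr_ge0.
- exact: measurable_funeM.
- by rewrite -EFinM lee_fin mulr_ge0.
- exact: measurable_funeM.
Qed.

Lemma integral_Ecst (c : R) : (\int[P]_w c%:E = c%:E)%E.
Proof.
transitivity (c%:E * P setT)%E; first exact: (integral_cst P measurableT c%:E).
by rewrite probability_setT mule1.
Qed.

Lemma integral_indic_Pr S : measurable S ->
  (\int[P]_w (\1_S w)%:E = (Pr P S)%:E)%E.
Proof. by move=> mS; rewrite integral_indic// setIT; exact: PrE. Qed.

(** The p-th power of the norm: being an integral, it can be bounded term by term, and a factor 2^p
    in place of Minkowski's inequality does no harm. *)
Definition mom (p : R) X : \bar R := (\int[P]_w (`|X w| `^ p)%:E)%E.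

Lemma measurable_normpow (p : R) X : measurable_fun setT X ->
  measurable_fun setT (fun w => `|X w| `^ p).
Proof.
move=> mX; apply: (measurableT_comp (measurable_powR p)).
by apply: (measurableT_comp _ mX); exact: normr_measurable.
Qed.

Lemma mom_ge0 p X : (0 <= mom p X)%E.
Proof. by apply: integral_ge0 => w _; rewrite lee_fin powR_ge0. Qed.

Lemma le_mom p X Y : 0 <= p -> measurable_fun setT X -> measurable_fun setT Y ->
  (forall w, `|X w| <= `|Y w|) -> (mom p X <= mom p Y)%E.
Proof.
move=> p0 mX mY XY.
apply: le_integral_EFin => [//|||w|w]; rewrite ?powR_ge0//.
- exact: measurable_normpow.
- exact: measurable_normpow.
- by rewrite ge0_ler_powR ?nnegrE.
Qed.

Lemma Lnorm_mom (p : R) X : 0 < p ->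
  ('N[P]_(p%:E)[EFin \o X] `^ p = mom p X)%E.
Proof.
move=> p0; rewrite poweR_Lnorm ?gt_eqF//; exact: eq_integral.
Qed.

Lemma Lnorm_lt (p e : R) X : 0 < p -> 0 < e ->
  ('N[P]_(p%:E)[EFin \o X] < e%:E)%E <-> (mom p X < (e `^ p)%:E)%E.
Proof.
move=> p0 e0; rewrite -Lnorm_mom//; have := Lnorm_ge0 P p%:E (EFin \o X).
case: (Lnorm _ _ _) => [r| |]//; last first.
  by move=> _; rewrite poweRyr ?gt_eqF//; split; rewrite ltNge leey.
rewrite lee_fin poweR_EFin !lte_fin => r0; split => [re|].
  by apply: gt0_ltr_powR; rewrite ?nnegrE// ltW.
apply: contraTT; rewrite -!leNgt => er.
by apply: ge0_ler_powR; rewrite ?nnegrE// ltW.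
Qed.

Lemma LpP (p : R) X : 0 < p ->
  Lp P p X <-> measurable_fun setT X /\ (mom p X < +oo)%E.
Proof.
move=> p0; rewrite /Lp -Lnorm_mom//; have := Lnorm_ge0 P p%:E (EFin \o X).
by case: (Lnorm _ _ _) => [r| |]//= _; rewrite ?poweRyr ?gt_eqF// ?poweR_EFin ?ltry.
Qed.

Lemma normpowD (p a b : R) : 0 <= p ->
  `|a + b| `^ p <= 2 `^ p * (`|a| `^ p + `|b| `^ p).
Proof.
move=> p0; wlog ab : a b / `|a| <= `|b|.
  move=> h; have [/h//|/ltW /h] := leP `|a| `|b|.
  by rewrite addrC (addrC (_ `^ _)).
have : `|a + b| <= 2 * `|b|.
  by rewrite (le_trans (ler_normD _ _))//; lra.
move/(ge0_ler_powR p0); rewrite !nnegrE normr_ge0 mulr_ge0// => /(_ isT isT).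
move/le_trans; apply.
by rewrite powRM// ler_wpM2l ?powR_ge0// lerDr powR_ge0.
Qed.

Lemma momD (p : R) X Y : 0 <= p -> measurable_fun setT X -> measurable_fun setT Y ->
  (mom p (fun w => X w + Y w)%R <= (2 `^ p)%:E * (mom p X + mom p Y))%E.
Proof.
move=> p0 mX mY; have mXY : measurable_fun setT (fun w => X w + Y w).
  exact: measurable_funD.
have N0 (Z : T -> R) w : 0 <= `|Z w| `^ p by exact: powR_ge0.
have C0 : 0 <= 2 `^ p :> R by exact: powR_ge0.
rewrite /mom ge0_muleDr ?mom_ge0//.
rewrite -(integral_lin measurableT (measurable_normpow p mX) (measurable_normpow p mY)
  (N0 X) (N0 Y) C0 C0).
apply: le_integral_EFin => [//|||w|w].
- exact: measurable_normpow.
- by apply: measurable_funD; apply: measurable_funM => //; exact: measurable_normpow.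
- exact: powR_ge0.
- by rewrite -mulrDr normpowD.
Qed.

Definition clip (k x : R) : R := Num.max (- k) (Num.min k x).

Lemma norm_clip k x : 0 <= k -> `|clip k x| <= k.
Proof.
by move=> k0; rewrite /clip maxEle minEle ler_norml; case: ifP; case: ifP; lra.
Qed.

Lemma norm_clip_le k x : 0 <= k -> `|clip k x| <= `|x|.
Proof.
move=> k0; rewrite ler_norml /clip maxEle minEle; have := ler_norm x; have := ler_norm (-
  x).
by rewrite normrN; case: ifP; case: ifP; lra.
Qed.

Lemma norm_sub_clip k x : 0 <= k -> `|x - clip k x| <= `|x|.
Proof.
move=> k0; rewrite ler_norml /clip maxEle minEle; have := ler_norm x; have := ler_norm (-
  x).
by rewrite normrN; case: ifP; case: ifP; lra.
Qed.

Lemma clip_id k x : `|x| <= k -> clip k x = x.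
Proof. by rewrite ler_norml /clip maxEle minEle; case: ifP; case: ifP; lra. Qed.

Lemma measurable_clip k X : measurable_fun setT X -> measurable_fun setT (clip k \o X).
Proof.
move=> mX; apply: measurable_maxr; first exact: measurable_cst.
by apply: measurable_minr => //; exact: measurable_cst.
Qed.

Lemma clip_bmeas k X : 0 <= k -> measurable_fun setT X -> bmeas (clip k \o X).
Proof.
by move=> k0 mX; split; [exact: measurable_clip|exists k => w; exact: norm_clip].
Qed.

(** Dominated convergence along integer truncation levels, with |X|^p as dominating function. *)
Lemma mom_sub_clip (p e : R) X : 0 < p -> measurable_fun setT X ->
  (mom p X < +oo)%E -> 0 < e ->
  exists k, 0 <= k /\ (mom p (fun w => X w - clip k (X w))%R < e%:E)%E.
Proof.
move=> p0 mX fX e0.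
pose f_ (n : nat) w := (`|X w - clip n%:R (X w)| `^ p)%:E.
have mf_ n : measurable_fun setT (f_ n).
  apply/measurable_EFinP/measurable_normpow; apply: measurable_funB => //.
  exact: measurable_clip.
have [||||_ _ cv] := @dominated_convergence _ _ _ P setT measurableT f_ (fun=> 0%E)
    (fun w => (`|X w| `^ p)%:E) mf_.
- exact: measurable_cst.
- apply: aeW => w _; apply: cvg_near_cst; near=> n.
  rewrite /f_ clip_id ?subrr ?normr0 ?powR0 ?gt_eqF//.
  near: n; exact: nbhs_infty_ger.
- apply/integrableP; split; first exact/measurable_EFinP/measurable_normpow.
  by under eq_integral do rewrite gee0_abs ?lee_fin ?powR_ge0//.
- apply: aeW => w n _; rewrite /f_ gee0_abs ?lee_fin ?powR_ge0//.
  by apply: ge0_ler_powR; rewrite ?nnegrE//; [exact: ltW|exact: norm_sub_clip].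
move: cv; rewrite integral0 => cv.
have /cv : nbhs (0%E : \bar R) [set x | (x < e%:E)%E].
  by apply: open_nbhs_nbhs; split; [exact: open_ereal_lt_ereal|rewrite /= lte_fin].
by move=> [n _ /(_ n (leqnn n)) /= h]; exists n%:R; split.
Unshelve. all: by end_near.
Qed.

(* [|x| <= eta] or [|x| / eta <= (|x| / eta) ^ p] *)
Lemma norm_le_pow (p eta x : R) : 1 <= p -> 0 < eta ->
  `|x| <= eta + (eta * eta^-1 `^ p) * `|x| `^ p.
Proof.
move=> p1 eta0; have [xe|xe] := leP `|x| eta.
  by rewrite (le_trans xe)// lerDl !mulr_ge0 ?powR_ge0// ltW.
have : `|x| / eta <= (`|x| / eta) `^ p.
  by apply: le1r_powR => //; rewrite ler_pdivlMr// mul1r ltW.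
rewrite (powRM _ (normr_ge0 x)) ?invr_ge0; last exact: ltW.
rewrite ler_pdivrMr// => /le_trans; apply.
rewrite (_ : _ * _ * eta = eta * eta^-1 `^ p * `|x| `^ p); last by ring.
by rewrite lerDr ltW.
Qed.

(** Stands in for Hölder's inequality, uniformly in p >= 1: with eta fixed first, a small moment
    makes the integral over any set small. *)
Lemma Rintegral_le_mom (p eta r : R) X S : 1 <= p -> 0 < eta -> bmeas X ->
  measurable S -> (mom p X <= r%:E)%E ->
  \int[P]_(w in S) X w <= eta + (eta * eta^-1 `^ p) * r.
Proof.
move=> p1 eta0 bX mS Xr; have [mX _] := bX.
have p0 : 0 <= p by rewrite (le_trans _ p1).
pose C := eta * eta^-1 `^ p.
have C0 : 0 <= C by rewrite mulr_ge0 ?powR_ge0// ltW.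
rewrite -lee_fin /Rintegral fineK; last first.
  by apply: integrable_fin_num => //; exact: bmeas_integrable.
have mN := measurable_normpow p mX.
have mR : measurable_fun setT (fun w => eta * 1 + C * `|X w| `^ p).
  by apply: measurable_funD => //; apply: measurable_funM.
have R0 w : 0 <= eta * 1 + C * `|X w| `^ p.
  by rewrite addr_ge0 ?mulr_ge0 ?powR_ge0// ltW.
apply: (@le_trans _ _ (\int[P]_(w in S) `|(X w)%:E|)%E).
  rewrite (le_trans (lee_abs _))// le_abse_integral//.
  by apply/measurable_EFinP; exact: measurable_funTS.
apply: (@le_trans _ _ (\int[P]_(w in S) (eta * 1 + C * `|X w| `^ p)%:E)%E).
  apply: le_integral_EFin => // [|w].
  - exact: measurableT_comp.
  - by rewrite mulr1 norm_le_pow.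
apply: (@le_trans _ _ (\int[P]_w (eta * 1 + C * `|X w| `^ p)%:E)%E).
  apply: ge0_subset_integral => //; first exact/measurable_EFinP.
  by move=> w _; rewrite lee_fin.
have N0 w : 0 <= `|X w| `^ p by exact: powR_ge0.
have one0 (w : T) : 0 <= 1 :> R by [].
rewrite (integral_lin measurableT (measurable_cst (1 : R)) mN one0 N0 (ltW eta0) C0).
have CX : (C%:E * mom p X <= (C * r)%:E)%E.
  by rewrite (EFinM C r); apply: lee_wpmul2l; rewrite ?lee_fin.
by rewrite integral_Ecst mule1 EFinD; exact: leeD.
Qed.
End Moments.

(** * Interior points and continuity in Lp *)

Lemma pos_lower_bound {R : realType} (I : finType) (F : I -> R) :
  exists e, 0 < e /\ forall i, 0 < F i -> e <= F i.
Proof.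
have main (s : seq I) : exists e, 0 < e /\ forall i, i \in s -> 0 < F i -> e <= F i.
  elim: s => [|i s [e [e0 eP]]]; first by exists 1.
  have [Fi|Fi] := ltP 0 (F i).
    exists (Num.min e (F i)); split; first by rewrite lt_min e0.
    move=> j; rewrite inE => /orP[/eqP -> _|js Fj]; rewrite ge_min ?lexx ?orbT//.
    by rewrite eP.
  exists e; split => // j; rewrite inE => /orP[/eqP ->|]; last exact: eP.
  by rewrite ltNge Fi.
have [e [e0 eP]] := main (index_enum I).
by exists e; split => // i; apply: eP; rewrite mem_index_enum.
Qed.

Section Continuity.
Context {R : realType} {d : measure_display} {T : measurableType d}.
Variables (P : probability T R) (A : set (T -> R)).
Hypothesis naP : nonatomic P.
Hypothesis AS : acceptance_set P A.
Hypothesis CV : convex_acc A.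
Hypothesis LI : law_invariant P A.
Implicit Types X Y Z : T -> R.
Local Notation rho := (rho A).

Lemma bmeasD X Y : bmeas X -> bmeas Y -> bmeas (fun w => X w + Y w).
Proof.
move=> [mX [K XK]] [mY [L YL]]; split; first exact: measurable_funD.
by exists (K + L) => w; rewrite (le_trans (ler_normD _ _))// lerD.
Qed.

Lemma bmeasZ (a : R) X : bmeas X -> bmeas (fun w => a * X w).
Proof.
move=> [mX [K XK]]; split; first exact: measurable_funM.
by exists (`|a| * K) => w; rewrite normrM ler_wpM2l.
Qed.

Lemma bmeas_cst (a : R) : bmeas (fun _ : T => a).
Proof. by split; [exact: measurable_cst|exists `|a|]. Qed.

Lemma bmeasB X Y : bmeas X -> bmeas Y -> bmeas (fun w => X w - Y w).
Proof.
move=> bX bY; have := bmeasD bX (bmeasZ (-1) bY).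
by under eq_fun do rewrite mulN1r.
Qed.

Lemma bmeas_norm X : bmeas X -> exists K, 0 <= K /\ forall w, `|X w| <= K.
Proof.
move=> [_ [K XK]]; exists K; split => //.
exact: le_trans (normr_ge0 _) (XK point).
Qed.

Lemma Linf_clip X : Linf P X -> exists K, 0 <= K /\
  {ae P, forall w, X w = clip K (X w)}.
Proof.
move=> [_ [K XK]]; exists `|K|; split => //.
by apply: filterS XK => w XK; rewrite clip_id// (le_trans XK)// ler_norm.
Qed.

(* Finitely many classes of [X] with oscillation at most [eta], and a value [v]
   representing each class. *)
Lemma simple_approx X (eta : R) : bmeas X -> 0 < eta ->
  exists (I : finType) (c : T -> I) (v : I -> R),
    mclass c /\ forall w, `|X w - v (c w)| <= eta.
Proof.
move=> bX eta0; have [K [K0 XK]] := bmeas_norm bX; have [mX _] := bX.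
have [N /(_ 1 ltr01)[a [e [_ aP _]]]] := good_grid (law P mX) K0 eta0.
pose v k := xget 0 [set x | `|x| <= K /\ bits a x = k].
exists {ffun 'I_N -> bool}, (bits a \o X), v; split; first exact: bits_mclass.
move=> w; apply: aP => //.
have [_ /= vE] : [set x | `|x| <= K /\ bits a x = bits a (X w)] (v (bits a (X w))).
  by rewrite /v; apply: xgetPex; exists (X w); split.
by rewrite [RHS]vE.
Qed.

(** On the classes of positive mass, hence of mass at least [dl], an integral error of eta * dl is
    an error eta in the conditional mean. So [v] nearly dominates the conditional means of an
    acceptable [Z] close to [Y]. *)
Lemma rho_le0_closure p Y : 1 <= p -> bmeas Y -> Clp P p A Y -> rho Y <= 0.
Proof.
move=> p1 bY [_ clY]; have p0 : 0 < p by rewrite (lt_le_trans _ p1).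
apply/ler_addgt0Pr => e0 e00; rewrite add0r.
(* One eta for [Y] against [v], one for [v] against the means of [Y], one for the means of [Y]
   against those of [Z]. *)
pose eta := e0 / 3; have eta0 : 0 < eta by rewrite divr_gt0.
have [I [c [v [mc vP]]]] := simple_approx bY eta0.
pose pr k := Pr P (c @^-1` [set k]).
have [dl [dl0 dlP]] := pos_lower_bound pr.
pose s := eta * dl; have s0 : 0 < s by rewrite mulr_gt0.
pose t := s / 2; have t0 : 0 < t by rewrite divr_gt0.
pose C := t * t^-1 `^ p.
have C0 : 0 <= C by rewrite mulr_ge0 ?powR_ge0// ltW.
(* Makes t + C r at most s, where t + C r is the bound of [Rintegral_le_mom] for Z - Y. *)
pose r := t / (C + 1).
have r0 : 0 < r by rewrite divr_gt0// ltr_pwDr.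
have Cr : C * r <= t.
  have C1 : 0 < C + 1 by rewrite ltr_pwDr.
  by rewrite /r mulrCA ler_piMr//; [exact: ltW|rewrite ler_pdivrMr// mul1r lerDl].
have [Z' [AZ' YZ']] := clY (r `^ p^-1) (powR_gt0 _ r0).
have LZ' : Linf P Z' by have [AL _ _ _] := AS; exact: AL.
have [K [K0 ZK]] := Linf_clip LZ'.
pose Z := clip K \o Z'; have bZ : bmeas Z by apply: clip_bmeas => //; have [] := LZ'.
have AZ : A Z.
  apply: (acc_mono AS AZ' (bmeas_Linf P bZ)).
  by apply: filterS ZK => w; rewrite /Z /= => <-.
have bD : bmeas (fun w => Z w - Y w) by exact: bmeasB.
have Dr : (mom P p (fun w => Z w - Y w)%R <= r%:E)%E.
  move: YZ'; rewrite /Lpdist Lnorm_lt ?powR_gt0// -powRrM mulVf ?gt_eqF// (powRr1 (ltW r0)).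
  move/ltW; apply: le_trans; rewrite le_eqVlt; apply/orP; left; apply/eqP.
  apply: ae_eq_integral => //.
  - by apply/measurable_EFinP/measurable_normpow; have [] := bD.
  - apply/measurable_EFinP/measurable_normpow; apply: measurable_funB.
      by have [] := bY.
    by have [] := LZ'.
  - by apply: filterS ZK => w ZK _; rewrite /Z /= -ZK distrC.
have rZ : rho Z <= 0.
  apply: (rho_le AS (bmeas_Linf P bZ)).
  by under eq_fun do rewrite addr0.
have : rho Y <= rho (v \o c) + eta.
  apply: (rho_shift_le AS); [exact/bmeas_Linf/mclass_bmeas|exact: bmeas_Linf|].
  by apply: aeW => w /=; have := vP w; rewrite ler_norml; lra.
have : rho (v \o c) <= rho Z + (eta + eta).
  apply: (rho_cond_mean AS CV LI naP mc bZ) => k.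
  have -> : \int[P]_(w in c @^-1` [set k]) Z w =
      \int[P]_(w in c @^-1` [set k]) Y w + \int[P]_(w in c @^-1` [set k]) (Z w - Y w).
    rewrite -RintegralD//; [|exact: bmeas_integrable..].
    by apply: eq_Rintegral => w _; ring.
  have -> : (v k + (eta + eta)) * Pr P (c @^-1` [set k]) =
    (v k + eta) * pr k + eta * pr k by rewrite /pr; ring.
  apply: lerD.
    rewrite -Rintegral_cst//; apply: le_Rintegral => //.
    - exact: bmeas_integrable.
    - exact: finite_measure_integrable_cst.
    - by move=> w /= <-; have := vP w; rewrite ler_norml; lra.
  have [prk|prk] := ltP 0 (pr k).
    rewrite (le_trans (Rintegral_le_mom p1 t0 bD (mc k) Dr))// -/C.
    rewrite (le_trans (_ : _ <= s))//; first by rewrite /t in Cr *; lra.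
    by rewrite ler_pM2l// dlP.
  have prk0 : P (c @^-1` [set k]) = 0%E.
    rewrite PrE//; congr (_%:E); apply/eqP.
    by rewrite eq_le prk Pr_ge0.
  rewrite /Rintegral null_set_integral//; last first.
    by apply/measurable_EFinP/measurable_funTS; have [] := bD.
  by rewrite /pr /Pr prk0 mulr0.
by rewrite /eta; lra.
Qed.

Definition bounded_near0 (p : R) : Prop := exists e C, 0 < e /\
  forall X, bmeas X -> (mom P p X <= e%:E)%E -> rho X <= C.

(** The centre X0 may be unbounded, so a small X is added to its truncation at level K: the sum is
    bounded and lies in the ball, and removing the truncation changes [rho] by at most K. *)
Lemma interior_bounded_near0 p : 1 <= p ->
  Lp_interior_nonempty P p A -> bounded_near0 p.
Proof.
move=> p1 [X0 [LX0 [e [e0 eP]]]]; have p0 : 0 < p by rewrite (lt_le_trans _ p1).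
have [mX0 fX0] := (LpP P X0 p0).1 LX0.
pose C := 2 `^ p : R; have C0 : 0 < C by exact: powR_gt0.
(* X and the truncation error contribute C (k + k), which is half of e^p. *)
pose k := e `^ p / (4 * C).
have k0 : 0 < k by rewrite divr_gt0 ?powR_gt0// mulr_gt0.
have [K [K0 XK]] := mom_sub_clip p0 mX0 fX0 k0.
have bZ := clip_bmeas K0 mX0.
exists k, K; split => // X bX Xk; have [mX _] := bX.
have bY := bmeasD bX bZ; have [mY _] := bY.
have mD : measurable_fun setT (fun w => X0 w - clip K (X0 w)).
  by apply: measurable_funB => //; exact: measurable_clip.
have mN : measurable_fun setT (fun w => - (X0 w - clip K (X0 w))).
  exact: measurable_funN.
have Yd : (Lpdist P p (fun w => X w + (clip K \o X0) w)%R X0 < e%:E)%E.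
  rewrite /Lpdist Lnorm_lt//.
  rewrite (_ : _ \- X0 = fun w => X w + - (X0 w - clip K (X0 w))); last first.
    by apply/funext => w /=; ring.
  apply: (le_lt_trans (momD P (ltW p0) mX mN)); rewrite -/C.
  have -> : mom P p (fun w => - (X0 w - clip K (X0 w))) =
      mom P p (fun w => X0 w - clip K (X0 w)).
    by rewrite /mom; under eq_integral do rewrite normrN.
  apply: (@le_lt_trans _ _ (C%:E * (k%:E + k%:E))%E).
    by apply: lee_wpmul2l; [rewrite lee_fin ltW|apply: leeD => //; exact: ltW].
  rewrite -EFinD -EFinM lte_fin /k.
  rewrite (_ : C * _ = e `^ p / 2); last by field; rewrite gt_eqF.
  by rewrite ltr_pdivrMr// ltr_pMr ?powR_gt0// ltr1n.
have LY : Lp P p (fun w => X w + (clip K \o X0) w).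
  apply/(LpP _ _ p0); split => //; apply: (le_lt_trans (momD P (ltW p0) mX
    (measurable_clip K mX0))).
  apply: lte_mul_pinfty; rewrite ?lee_fin ?powR_ge0//.
  rewrite lte_add_pinfty//; first by rewrite (le_lt_trans Xk)// ltry.
  apply: le_lt_trans fX0; apply: le_mom; [exact: ltW|exact: measurable_clip|by []|].
  by move=> w; exact: norm_clip_le.
have := rho_le0_closure p1 bY (eP _ LY Yd).
have : rho X <= rho (fun w => X w + (clip K \o X0) w) + K.
  apply: (rho_shift_le AS); [exact: bmeas_Linf|exact: bmeas_Linf|].
  by apply: aeW => w /=; have := norm_clip (X0 w) K0; rewrite ler_norml; lra.
lra.
Qed.

Lemma bounded_near0_interior p : 1 <= p ->
  bounded_near0 p -> Lp_interior_nonempty P p A.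
Proof.
move=> p1 [e [C [e0 eP]]]; have p0 : 0 < p by rewrite (lt_le_trans _ p1).
have finC (c : R) : (mom P p (fun=> c) < +oo)%E.
  by rewrite /mom integral_Ecst ltry.
(* C + 1 and not C, because [acc_rho] asks for a strict inequality. *)
exists (fun=> C + 1); split; first by apply/(LpP _ _ p0); split => //; exact:
  measurable_cst.
exists (e `^ p^-1); split; first exact: powR_gt0.
move=> Y LY; have [mY fY] := (LpP P Y p0).1 LY.
rewrite /Lpdist Lnorm_lt ?powR_gt0// -powRrM mulVf ?gt_eqF// powRr1 ?ltW// => Ye.
pose D w := Y w - (C + 1); have mD : measurable_fun setT D by exact: measurable_funB.
split => // r r0.
have [K [K0 DK]] := mom_sub_clip p0 mD (lt_trans Ye (ltry _)) (powR_gt0 p r0).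
have bDK := clip_bmeas K0 mD; have [mDK _] := bDK.
exists (fun w => (clip K \o D) w + (C + 1)); split.
  apply: (acc_rho AS); first exact: bmeas_Linf.
  rewrite (le_lt_trans (eP _ bDK _)) ?ltrDl//.
  apply: (le_trans _ (ltW Ye)); apply: le_mom => //; first exact: ltW.
  by move=> w; exact: norm_clip_le.
rewrite /Lpdist Lnorm_lt//; apply: le_lt_trans DK.
rewrite (_ : _ \- _ = fun w => D w - clip K (D w))//.
by apply/funext => w; rewrite /D /=; ring.
Qed.

(* The standard argument for convex functions: [Y] is the convex combination
   [(1 - l) X + l (X + (Y - X) / l)], and [X] is a convex combination of [Y] and
   [X - (Y - X) / l]. *)
Lemma rho_continuous p X (e : R) : 1 <= p -> bounded_near0 p -> bmeas X -> 0 < e ->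
  exists k, 0 < k /\ forall Y, bmeas Y ->
    (mom P p (fun w => Y w - X w)%R <= k%:E)%E -> `|rho Y - rho X| <= e.
Proof.
move=> p1 [k [C [k0 kP]]] bX e0; have p0 : 0 < p by rewrite (lt_le_trans _ p1).
have [M [M0 XM]] := bmeas_norm bX.
(* In both directions the increment of [rho] is at most l (C + M - rho X), hence at most l B. *)
pose B := `|C| + M + `|rho X| + 1.
have B1 : 1 <= B by rewrite lerDr !addr_ge0.
pose l := Num.min 1 (e / B).
have l0 : 0 < l by rewrite lt_min ltr01 divr_gt0// (lt_le_trans _ B1).
have l1 : l <= 1 by rewrite ge_min lexx.
have lB : l * B <= e.
  by rewrite -ler_pdivlMr ?(lt_le_trans _ B1)// ge_min lexx orbT.
exists (l `^ p * k); split; first by rewrite mulr_gt0 ?powR_gt0.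
move=> Y bY Yk; pose D w := Y w - X w.
have bD : bmeas D by exact: bmeasB.
have bound (s : R) : `|s| = l^-1 -> rho (fun w => X w + s * D w) <= C + M.
  move=> sl; have bsD : bmeas (fun w => s * D w) by exact: bmeasZ.
  have -> : C + M = rho (fun w => s * D w) + M + (C - rho (fun w => s * D w)) by ring.
  rewrite ler_wpDr//.
    rewrite subr_ge0 kP//.
    have -> : mom P p (fun w => s * D w) = (((l `^ p)^-1)%:E * mom P p D)%E.
      have mDp : measurable_fun setT (fun w => (`|D w| `^ p)%:E).
        by apply/measurable_EFinP/measurable_normpow; have [] := bD.
      have N0 w : setT w -> (0 <= (`|D w| `^ p)%:E)%E by rewrite lee_fin powR_ge0.
      rewrite /mom -(ge0_integralZl P measurableT mDp N0); last first.
        by rewrite lee_fin invr_ge0 powR_ge0.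
      apply: eq_integral => w _; rewrite normrM sl powRM ?invr_ge0 ?(ltW l0)//.
      rewrite EFinM; congr (_%:E * _)%E; apply: (mulfI (lt0r_neq0 (powR_gt0 p l0))).
      rewrite mulfV ?gt_eqF ?powR_gt0// -powRM ?invr_ge0 ?(ltW l0)//.
      by rewrite mulfV ?powR1// gt_eqF.
    by rewrite lee_pdivrMl ?powR_gt0// -EFinM.
  apply: (rho_shift_le AS); [exact: bmeas_Linf|exact/bmeas_Linf/bmeasD|].
  by apply: aeW => w /=; have := XM w; rewrite ler_norml; lra.
have LX : Linf P X by exact: bmeas_Linf.
have LY : Linf P Y by exact: bmeas_Linf.
have rX := ler_norm (rho X); have rX' := ler_norm (- rho X); rewrite normrN in rX'.
have CC := ler_norm C.
have BE : B = `|C| + M + `|rho X| + 1 by [].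
rewrite ler_norml; apply/andP; split; last first.
  have L1 : Linf P (fun w => X w + l^-1 * D w) by exact/bmeas_Linf/bmeasD/bmeasZ.
  have := @rho_convex _ _ _ P A AS CV (fun w => X w + l^-1 * D w) X l L1 LX.
  rewrite (_ : (fun w => _) = Y); last first.
    by apply/funext => w; rewrite /D; field; rewrite gt_eqF.
  have -> : 0 <= l <= 1 by rewrite ltW.
  move=> /(_ isT) h.
  have := bound l^-1; rewrite ger0_norm ?invr_ge0 ?(ltW l0)// => /(_ erefl) h2.
  by nra.
(* The weight for which X = m (X - D / l) + (1 - m) Y. *)
pose m := l / (1 + l).
have m01 : 0 <= m <= 1.
  have l2 : 0 < 1 + l by rewrite ltr_pwDl// ltW.
  by apply/andP; split; [apply: divr_ge0; exact: ltW|rewrite ler_pdivrMr// mul1r lerDr].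
have L1 : Linf P (fun w => X w + - l^-1 * D w) by exact/bmeas_Linf/bmeasD/bmeasZ.
have := @rho_convex _ _ _ P A AS CV (fun w => X w + - l^-1 * D w) Y m L1 LY m01.
rewrite (_ : (fun w => _) = X); last first.
  apply/funext => w; rewrite /D /m; field.
  by apply/andP; split; apply: lt0r_neq0; lra.
have := bound (- l^-1); rewrite normrN ger0_norm ?invr_ge0 ?(ltW l0)// => /(_ erefl) h2 h.
have l2 : 0 < 1 + l by lra.
have mE : m * (1 + l) = l by rewrite divfK// gt_eqF.
have : rho X * (1 + l) <= (m * rho (fun w => X w + - l^-1 * D w) + (1 - m) * rho Y) * (1
  + l).
  by rewrite ler_pM2r.
rewrite mulrDl mulrAC mE.
have -> : (1 - m) * rho Y * (1 + l) = rho Y by rewrite mulrAC mulrBl mE; ring.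
by nra.
Qed.
End Continuity.

(** * Prohorov distance and the weak law of large numbers *)

Section Prohorov.
Context {R : realType}.
Implicit Types mu nu : probability R R.

Lemma measurable_nbhd_set (B : set R) e : measurable (nbhd_set B e).
Proof.
apply: open_measurable.
rewrite (_ : nbhd_set B e = \bigcup_(a in B) `](a - e), (a + e)[%classic).
  by apply: bigcup_open => a _; exact: itv_open.
apply/seteqP; split => [x [a Ba]|x [a Ba]].
  by rewrite ltr_distl => xa; exists a => //=; rewrite in_itv.
by rewrite /= in_itv/= => xa; exists a => //; rewrite ltr_distl.
Qed.

Lemma prohorov_le mu nu (e : R) : 0 < e ->
  (forall B, measurable B -> Pr mu B <= Pr nu (nbhd_set B e) + e /\
     Pr nu B <= Pr mu (nbhd_set B e) + e) -> prohorov mu nu <= e.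
Proof.
move=> e0 eP; apply: ge_inf; first by exists 0 => x [/ltW].
split => // B mB; have mN := measurable_nbhd_set B e.
by rewrite !PrE// -!EFinD !lee_fin; exact: eP.
Qed.

Lemma prohorov_lt mu nu (t : R) : prohorov mu nu < t ->
  exists e, [/\ 0 < e, e < t & forall B, measurable B ->
    Pr mu B <= Pr nu (nbhd_set B e) + e /\ Pr nu B <= Pr mu (nbhd_set B e) + e].
Proof.
move=> mt; have t0 : 0 < t - prohorov mu nu by rewrite subr_gt0.
have [|e [e0 eP]] := @inf_adherent R [set e : R | 0 < e /\ forall B : set R, measurable B ->
    (mu B <= nu (nbhd_set B e) + e%:E)%E /\ (nu B <= mu (nbhd_set B e) + e%:E)%E] _ t0.
  split; last by exists 0 => x [/ltW].
  exists 1; split => // B mB; have mN := measurable_nbhd_set B 1.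
  rewrite !PrE// -!EFinD !lee_fin; split.
    by rewrite (le_trans (Pr_le1 mu mB))// lerDr Pr_ge0.
  by rewrite (le_trans (Pr_le1 nu mB))// lerDr Pr_ge0.
rewrite -/(prohorov mu nu) subrKC => et; exists e; split => // B mB.
have mN := measurable_nbhd_set B e.
by have := eP B mB; rewrite !PrE// -!EFinD !lee_fin.
Qed.

Lemma measurable_dist_lt (r s : R) : measurable [set x : R | `|x - r| < s].
Proof.
rewrite (_ : [set _ | _] = `](r - s), (r + s)[%classic); first exact: measurable_itv.
by apply/seteqP; split => x /=; rewrite in_itv/= ltr_distl.
Qed.

(** Either B meets the ball, whose points are then all within 2 s of B, or B misses it and has mass
    at most s. *)
Lemma prohorov_concentrated mu nu (r s : R) : 0 < s ->
  1 - s <= Pr mu [set x | `|x - r| < s] -> 1 - s <= Pr nu [set x | `|x - r| < s] ->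
  prohorov mu nu <= 2 * s.
Proof.
move=> s0.
pose U := [set x : R | `|x - r| < s]; have mU : measurable U := measurable_dist_lt r s.
have half (m m' : probability R R) B : measurable B ->
    1 - s <= Pr m U -> 1 - s <= Pr m' U -> Pr m B <= Pr m' (nbhd_set B (2 * s)) + 2 * s.
  move=> mB mUs mUs'; have mN := measurable_nbhd_set B (2 * s).
  have [[b Bb br]|] := pselect (exists2 b, B b & `|b - r| < s).
    have : Pr m' U <= Pr m' (nbhd_set B (2 * s)).
      apply: le_Pr => // x /= xr; exists b => //.
      move: (xr : `|x - r| < s) br; rewrite !ltr_norml => /andP[? ?] /andP[? ?].
      by apply/andP; split; lra.
    by have := Pr_le1 m mB; lra.
  move=> nB; have : Pr m B <= Pr m (~` U).
    by apply: le_Pr => //; [exact: measurableC|move=> x Bx Ux; apply: nB; exists x].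
  by rewrite PrC//; have := Pr_ge0 m' (nbhd_set B (2 * s)); lra.
move=> hm hn; apply: prohorov_le; first by rewrite mulr_gt0.
by move=> B mB; split; exact: half.
Qed.

(** A neighbourhood of a union of cells exceeds it only near the thresholds. The lower bound on a
    cell is the upper bound on its complement. *)
Lemma prohorov_bits mu nu K (a : 'I_K -> R) (e th : R) : prohorov mu nu < e -> e <= th ->
  Pr mu (near_thresholds a e) <= th ->
  forall k, `|Pr nu (bits a @^-1` [set k]) - Pr mu (bits a @^-1` [set k])| <= 2 * th.
Proof.
move=> /prohorov_lt[t [t0 te tP]] eth nth k.
have mb : mclass (bits a) by exact: (@bits_mclass R _ R id).
have mN := measurable_near a e.
have main (D : set {ffun 'I_K -> bool}) :
    Pr nu (bits a @^-1` D) <= Pr mu (bits a @^-1` D) + 2 * th.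
  have mD := mclass_preimage D mb.
  have [_ /le_trans] := tP _ mD; apply.
  have : Pr mu (nbhd_set (bits a @^-1` D) t) <=
      Pr mu (bits a @^-1` D `|` near_thresholds a e).
    apply: le_Pr; [exact: measurable_nbhd_set|exact: measurableU|].
    move=> x [y Dy xy]; have [nx|nx] := pselect (near_thresholds a e x); first by right.
    by left; rewrite /preimage /= (bits_near (lt_trans xy te) nx).
  have := le_PrU mu mD mN; lra.
have := main [set k]; have := main (~` [set k]).
by rewrite -!preimage_setC !PrC// ler_norml; lra.
Qed.
End Prohorov.

Section WeakLaw.
Context {R : realType} {d : measure_display} {T : measurableType d}.
Variable Q : probability T R.

Lemma markov_Pr (f : T -> R) (k : R) : measurable_fun setT f -> (forall w, 0 <= f w) ->
  0 < k -> (k%:E * Q [set w | k <= f w]%R <= \int[Q]_w (f w)%:E)%E.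
Proof.
move=> mf f0 k0; pose E := [set w | k <= f w].
have mE : measurable E.
  rewrite (_ : E = setT `&` f @^-1` `[k, +oo[); first exact: mf.
  by rewrite setTI; apply/seteqP; split => w /=; rewrite in_itv/= andbT.
rewrite -/E -[E]setIT -integral_indic//.
rewrite -(ge0_integralZl Q measurableT) => [|||]; last 3 first.
- by apply/measurable_EFinP; exact: measurable_indic.
- by move=> w _; rewrite lee_fin.
- by rewrite lee_fin ltW.
under eq_integral do rewrite -EFinM.
apply: le_integral_EFin => // [|w|w].
- by apply: measurable_funM => //; exact: measurable_indic.
- by rewrite mulr_ge0// ltW.
- rewrite indicE; case: (boolP (w \in E)) => [/set_mem|_]; rewrite ?mulr1 ?mulr0//.
Qed.

(** Chebyshev's inequality. The vector of indicators takes finitely many values, so the second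
    moment is a finite sum; pairwise independence kills its off-diagonal terms, and the n diagonal
    ones are at most 1. *)
Lemma weak_law (E : nat -> set T) (a th : R) n : 0 < th ->
  (forall i, measurable (E i)) -> (forall i, Pr Q (E i) = a) ->
  (forall i j, (i < n)%N -> (j < n)%N -> i != j -> Pr Q (E i `&` E j) = a * a) ->
  (0 < n)%N ->
  measurable [set w | th <= `|n%:R^-1 * \sum_(i < n) \1_(E i) w - a|] /\
  Pr Q [set w | th <= `|n%:R^-1 * \sum_(i < n) \1_(E i) w - a|] <= (n%:R * th ^+ 2)^-1.
Proof.
move=> th0 mE Ea Eaa n0.
pose c w : {ffun 'I_n -> bool} := [ffun i : 'I_n => w \in E i].
have mc : mclass c.
  move=> k; rewrite (_ : _ @^-1` _ = \bigcap_(i : 'I_n) [set w | (w \in E i) = k i]).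
    apply: fin_bigcap_measurable => [|i _]; first exact: finite_finset.
    case: (k i).
      rewrite (_ : [set _ | _] = E i)//; apply/seteqP; split => w /=; first exact: set_mem.
      exact: mem_set.
    rewrite (_ : [set _ | _] = ~` E i); first exact: measurableC.
    by apply/seteqP; split => w /= => [/negbT/negP h /mem_set|h]; [|apply/negbTE/negP =>
      /set_mem].
  apply/seteqP; split => w /=.
    by move=> ck i _ /=; rewrite -ck ffunE.
  by move=> h; apply/ffunP => i; rewrite ffunE; exact: h.
pose s (k : {ffun 'I_n -> bool}) : R := \sum_(i < n) ((k i)%:R - a).
pose p k := Pr Q (c @^-1` [set k]).
have N0 : 0 < n%:R :> R by rewrite ltr0n.
pose D := [set k | th <= `|n%:R^-1 * s k|].
have DE : [set w | th <= `|n%:R^-1 * \sum_(i < n) \1_(E i) w - a|] = c @^-1` D.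
  apply/seteqP; have sE w : n%:R^-1 * s (c w) = n%:R^-1 * \sum_(i < n) \1_(E i) w - a.
    rewrite /s sumrB sumr_const card_ord mulrBr; congr (_ - _).
      by congr (_ * _); apply: eq_bigr => i _; rewrite ffunE indicE.
    by rewrite -[a *+ n]mulr_natl mulKf// gt_eqF.
  by split => w; rewrite /preimage /D /= sE.
have pE (i : 'I_n) : \sum_(k : {ffun 'I_n -> bool}) (k i)%:R * p k = a.
  rewrite -(Ea i) (_ : E i = c @^-1` [set k : {ffun 'I_n -> bool} | k i]); last first.
    by apply/seteqP; split => w /=; rewrite ffunE; [exact: mem_set|exact: set_mem].
  rewrite (Pr_preimage _ _ mc) [RHS]big_mkcond/=; apply: eq_bigr => k _.
  case: (boolP (k i)) => ki; rewrite ?mul1r ?mul0r; case: ifPn => //.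
    by move=> /negP; elim; apply: mem_set.
  by move=> /set_mem /= ki'; rewrite ki' in ki.
have pEE (i j : 'I_n) : i != j -> \sum_(k : {ffun 'I_n -> bool}) (k i)%:R * (k j)%:R * p
  k = a * a.
  move=> ij; rewrite -(Eaa i j)// (_ : E i `&` E j = c @^-1` [set k : {ffun 'I_n -> bool}
    | k i && k j]); last first.
    apply/seteqP; split => w /=; rewrite !ffunE; first by move=> [? ?]; rewrite !mem_set.
    by move=> /andP[/set_mem ? /set_mem ?].
  rewrite (Pr_preimage _ _ mc) [RHS]big_mkcond/=; apply: eq_bigr => k _.
  case: ifPn => [/set_mem /andP[-> ->]|/negP kk]; first by rewrite !mul1r.
  case: (boolP (k i)) => ki; case: (boolP (k j)) => kj; rewrite ?mul0r ?mulr0 ?mul0r//.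
  by exfalso; apply: kk; apply: mem_set; rewrite /= ki kj.
have p1 : \sum_k p k = 1 by exact: sum_Pr.
have p0 k : 0 <= p k by exact: Pr_ge0.
have a0 : 0 <= a by rewrite -(Ea 0%N) Pr_ge0.
have var : \sum_(k : {ffun 'I_n -> bool}) (s k) ^+ 2 * p k <= n%:R.
  have -> : \sum_(k : {ffun 'I_n -> bool}) (s k) ^+ 2 * p k =
      \sum_(i < n) \sum_(j < n) \sum_(k : {ffun 'I_n -> bool}) ((k i)%:R - a) * ((k j)%:R
        - a) * p k.
    rewrite [RHS](eq_bigr (fun i : 'I_n => \sum_(k : {ffun 'I_n -> bool}) \sum_(j < n)
      ((k i)%:R - a) * ((k j)%:R - a) * p k)).
      rewrite exchange_big/=; apply: eq_bigr => k _.
      rewrite expr2 /s mulr_suml mulr_suml; apply: eq_bigr => i _.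
      by rewrite mulr_sumr mulr_suml.
    by move=> i _; rewrite exchange_big.
  rewrite -[leRHS]mulr1 mulr_natl -[X in _ *+ X](card_ord n) -sumr_const ler_sum// => i _.
  rewrite (bigD1 i)//= [X in _ + X]big1 ?addr0.
    rewrite -p1 ler_sum// => k _; rewrite ler_piMl//.
    by have := Pr_le1 Q (mE 0%N); rewrite Ea; case: (k i) => /= a1; nra.
  move=> j ji; rewrite eq_sym in ji.
  have -> : \sum_(k : {ffun 'I_n -> bool}) ((k i)%:R - a) * ((k j)%:R - a) * p k =
    \sum_(k : {ffun 'I_n -> bool}) (k i)%:R * (k j)%:R * p k - a * (\sum_(k : {ffun 'I_n
      -> bool}) (k i)%:R * p k)
    - a * (\sum_(k : {ffun 'I_n -> bool}) (k j)%:R * p k) + a * a * (\sum_(k : {ffun 'I_n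
      -> bool}) p k).
    rewrite !mulr_sumr -!sumrB -big_split/=; apply: eq_bigr => k _; ring.
  by rewrite pEE// !pE p1; ring.
rewrite DE; split; first exact: mclass_preimage.
rewrite Pr_preimage//.
have t0 : 0 < n%:R * th ^+ 2 by rewrite mulr_gt0 ?exprn_gt0.
rewrite -[leRHS]mul1r ler_pdivlMr//.
rewrite -(ler_pM2l N0) mulr1 (le_trans _ var)//.
have -> : n%:R * ((\sum_(k | k \in D) p k) * (n%:R * th ^+ 2)) =
    \sum_(k | k \in D) (n%:R * th) ^+ 2 * p k by rewrite -mulr_sumr; ring.
rewrite big_mkcond/= ler_sum// => k _; case: ifPn => [/set_mem kD|_]; last first.
  by rewrite mulr_ge0// sqr_ge0.
rewrite ler_wpM2r//.
rewrite -[leRHS]real_normK ?num_real// ler_sqr ?nnegrE ?mulr_ge0 ?(ltW th0) ?ler0n//.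
move: (kD : th <= `|n%:R^-1 * s k|); rewrite normrM ger0_norm ?invr_ge0 ?ler0n//.
by rewrite ler_pdivlMl.
Qed.

Lemma iid_pair (mu : probability R R) (X : nat -> T -> R) n (B : set R) i j :
  iid Q mu X -> measurable B -> (i < n)%N -> (j < n)%N -> i != j ->
  Pr Q (X i @^-1` B `&` X j @^-1` B) = Pr mu B * Pr mu B.
Proof.
move=> [mX lX iX] mB ni nj ij.
(* The whole line at all other indices reduces the product formula to the pair. *)
pose C k := if (k == i) || (k == j) then B else setT.
have mC k : measurable (C k) by rewrite /C; case: ifP.
apply: EFin_inj; rewrite -PrE; last first.
  by apply: measurableI; rewrite -[X in measurable X]setTI; exact: mX.
have := iX n C mC.
rewrite (bigD1 (Ordinal ni))//= (bigD1 (Ordinal nj))/=; last first.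
  by apply/eqP => -[ji]; rewrite ji eqxx in ij.
rewrite big1 ?mule1; last first.
  move=> k /andP[ki kj]; rewrite /C ifF ?preimage_setT ?probability_setT//.
  by apply/negbTE; rewrite negb_or; apply/andP; split; [move: ki|move: kj]; apply: contra
    => /eqP e; apply/eqP/val_inj.
rewrite /C !eqxx orbT/= !lX// EFinM -!PrE// => <-; congr (Q _).
apply/seteqP; split => w /=.
  by move=> [wi wj] k _; case: ifPn => [/orP[]/eqP ->|].
by move=> h; split; [have := h i ni|have := h j nj]; rewrite eqxx ?orbT.
Qed.
End WeakLaw.

(** * Robustness from continuity *)

Section Empirical.
Context {R : realType} {d : measure_display} {T : measurableType d}.
Variables (P : probability T R) (A : set (T -> R)).
Hypothesis naP : nonatomic P.
Hypothesis AS : acceptance_set P A.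
Hypothesis LI : law_invariant P A.
Local Notation rho := (rho A).

Lemma integral_mclass (I : finType) (f : T -> I) (v : I -> R) : mclass f ->
  (forall i, 0 <= v i) ->
  (\int[P]_w (v (f w))%:E = (\sum_i v i * Pr P (f @^-1` [set i]))%:E)%E.
Proof.
move=> mf v0.
have mI i : measurable_fun setT (\1_(f @^-1` [set i]) : T -> R).
  exact: measurable_indic.
have mvI i : measurable_fun setT (fun w => (v i * \1_(f @^-1` [set i]) w)%:E).
  by apply/measurable_EFinP/measurable_funM.
transitivity (\int[P]_w (\sum_i (v i * \1_(f @^-1` [set i]) w)%:E))%E.
  apply: eq_integral => w _; rewrite sumEFin (bigD1 (f w))//= indicE mem_set// mulr1.
  rewrite big1 ?addr0// => i /eqP fi; rewrite indicE memNset ?mulr0// => /= e.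
  by apply: fi; rewrite e.
rewrite ge0_integral_sum//; last first.
  by move=> i w _; rewrite lee_fin mulr_ge0.
rewrite -sumEFin; apply: eq_bigr => i _.
transitivity ((v i)%:E * \int[P]_w (\1_(f @^-1` [set i]) w)%:E)%E.
  rewrite -(ge0_integralZl P measurableT) => [//|||]; last 3 first.
  - exact/measurable_EFinP.
  - by move=> w _; rewrite lee_fin.
  - by rewrite lee_fin.
by rewrite integral_indic_Pr// -EFinM.
Qed.

(** [RA] evaluates [rho] at a representative picked by choice; law invariance makes every other one
    as good. *)
Lemma RA_rho (mu : set R -> \bar R) (X : T -> R) : Linf P X ->
  (forall B, measurable B -> P (X @^-1` B) = mu B) -> RA P A mu = rho X.
Proof.
move=> LX Xmu; rewrite /RA; set Y := xget _ _.
have [LY Ymu] : Linf P Y /\ forall B, measurable B -> P (Y @^-1` B) = mu B.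
  by rewrite /Y; apply: (@xgetPex _ _ [set X | Linf P X /\ forall B, measurable B ->
    P (X @^-1` B) = mu B]); exists X.
by apply: (rho_same_law LI) => // B mB; rewrite Ymu// Xmu.
Qed.

Lemma uniform_partition n : (0 < n)%N ->
  exists f : T -> 'I_n, mclass f /\ forall i, Pr P (f @^-1` [set i]) = n%:R^-1.
Proof.
move=> n0; have [||f fP] := @split_weights _ _ _ P naP 'I_n (Ordinal n0) setT
  (fun=> n%:R^-1) measurableT.
- by move=> i; rewrite invr_ge0.
- rewrite PrT sumr_const card_ord -[LHS]mulr_natl mulfV// pnatr_eq0.
  by rewrite -lt0n.
by exists f; split=> i; have := fP i; rewrite setTI => -[].
Qed.

Lemma empiricalE n (x : nat -> R) (f : T -> 'I_n) B : mclass f ->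
  (forall i, Pr P (f @^-1` [set i]) = n%:R^-1) ->
  P ((fun w => x (f w)) @^-1` B) = empirical n x B.
Proof.
move=> mf fn; pose D := [set i : 'I_n | B (x i)].
have mD := mclass_preimage D mf.
rewrite [LHS](PrE P mD) /empirical; congr (_%:E).
rewrite (Pr_preimage P D mf) mulr_sumr big_mkcond/=; apply: eq_bigr => i _.
rewrite indicE fn; case: ifPn => [/set_mem Bi|/negP Di].
  by rewrite mem_set// mulr1.
by rewrite memNset ?mulr0// => Bi; apply: Di; rewrite mem_set.
Qed.

Lemma RA_empirical n (x : nat -> R) (f : T -> 'I_n) : mclass f ->
  (forall i, Pr P (f @^-1` [set i]) = n%:R^-1) ->
  RA P A (empirical n x) = rho (fun w => x (f w)).
Proof.
move=> mf fn; apply: RA_rho; last by move=> B _; exact: empiricalE.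
exact/bmeas_Linf/(mclass_bmeas (fun i : 'I_n => x i) mf).
Qed.

Lemma RA_empirical_lipschitz n (x y : nat -> R) (e : R) : (0 < n)%N ->
  (forall i, (i < n)%N -> `|x i - y i| <= e) ->
  RA P A (empirical n x) <= RA P A (empirical n y) + e.
Proof.
move=> n0 xy; have [f [mf fn]] := uniform_partition n0.
rewrite !(RA_empirical _ mf fn); apply: (rho_shift_le AS).
- exact/bmeas_Linf/(mclass_bmeas (fun i : 'I_n => y i) mf).
- exact/bmeas_Linf/(mclass_bmeas (fun i : 'I_n => x i) mf).
by apply: aeW => w; have := xy _ (ltn_ord (f w)); rewrite ler_norml; lra.
Qed.

(** As a function of the n sample points the risk is 1-Lipschitz for the max norm. So {risk < t} is
    a countable union of cubes with rational centre q and radius t - h q. *)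
Lemma measurable_RA_empirical {d'} {T' : measurableType d'} (X : nat -> T' -> R) n :
  (0 < n)%N -> (forall i, measurable_fun setT (X i)) ->
  measurable_fun setT (fun w => RA P A (empirical n (fun i => X i w))).
Proof.
move=> n0 mX mT; apply: (measurability _ (RGenInftyO.measurableE R)) => //.
move=> /= _ [_ [t ->] <-]; rewrite setTI.
pose h (q : n.-tuple rat) := RA P A (empirical n (fun i => ratr (nth 0 q i))).
pose F (q : n.-tuple rat) := \bigcap_(i : 'I_n) X i @^-1`
  [set y | `|y - ratr (nth 0 q i)| < t - h q].
rewrite (_ : _ @^-1` _ = \bigcup_q F q).
  apply: countable_bigcupT_measurable => [|q]; first exact: countableP.
  apply: fin_bigcap_measurable => [|i _]; first exact: finite_finset.
  by rewrite -[X in measurable X]setTI; apply: mX => //; exact: measurable_dist_lt.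
apply/seteqP; split => w /=.
  rewrite in_itv/= => wt.
  pose g := RA P A (empirical n (fun i => X i w)).
  (* A rational q within eta of the sample has h q <= g + eta, so its radius is at least 2 eta. *)
  pose eta := (t - g) / 3; have eta0 : 0 < eta by rewrite divr_gt0// subr_gt0.
  have /choice[q qP] : forall i : 'I_n, exists q : rat, `|X i w - ratr q| < eta.
    move=> i; have [|q] := @rat_in_itvoo R (X i w - eta) (X i w + eta).
      by rewrite ltrD2l; lra.
    rewrite in_itv/= => /andP[q1 q2]; exists q.
    by rewrite ltr_norml; apply/andP; split; lra.
  pose q' := [tuple q i | i < n].
  have q'E (i : 'I_n) : nth 0 q' i = q i by rewrite -tnth_nth tnth_mktuple.
  exists q' => // i _ /=; rewrite q'E (lt_le_trans (qP i))//.
  have : h q' <= g + eta.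
    apply: RA_empirical_lipschitz => // j jn.
    by rewrite (q'E (Ordinal jn)) distrC ltW// (qP (Ordinal jn)).
  by rewrite /eta; lra.
move=> [q _ Fq]; rewrite in_itv/=.
pose m := \big[Num.max/0]_(i < n) `|X i w - ratr (nth 0 q i)|.
have m_lt : m < t - h q.
  rewrite /m; elim/big_ind: _ => // [|x y xt yt|i _]; last exact: Fq.
    by rewrite (le_lt_trans (normr_ge0 _) (Fq (Ordinal n0) I)).
  by rewrite gt_max xt.
have : RA P A (empirical n (fun i => X i w)) <= h q + m.
  apply: RA_empirical_lipschitz => // i ni.
  exact: (le_bigmax _ (fun i : 'I_n => `|X i w - ratr (nth 0 q i)|) (Ordinal ni)).
lra.
Qed.

(** Splits the moment through |y|^p <= L^p + tailpow p L y: the first term is bounded and the second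
    is small by uniform integrability. *)
Definition tailpow (p L y : R) : R := if `|y| <= L then 0 else `|y| `^ p.

Lemma tailpow_ge0 p L y : 0 <= tailpow p L y.
Proof. by rewrite /tailpow; case: ifP => _ //; exact: powR_ge0. Qed.

Lemma measurable_tailpow p L : measurable_fun setT (tailpow p L).
Proof.
rewrite /tailpow; apply: measurable_fun_ifT => //.
- by apply: measurable_fun_ler => //; exact: normr_measurable.
- by apply: measurable_normpow; exact: measurable_id.
Qed.

(** The deterministic part. Couple the sample with X: where the cells agree, the distance is at most
    eta; elsewhere its p-th power is at most 2^p (L^p + M^p + tail), on a set of mass at most th
    times the number of cells. *)
Lemma RA_close p (X : T -> R) (M L k e eta th kap : R) K (a : 'I_K -> R) n
    (x : nat -> R) : 1 <= p -> measurable_fun setT X -> (forall w, `|X w| <= M) ->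
  0 <= M -> 0 <= L -> 0 <= eta ->
  (forall Y, bmeas Y -> (mom P p (fun w => Y w - X w)%R <= k%:E)%E ->
     `|rho Y - rho X| <= e) ->
  (forall y z, `|y| <= M -> bits a y = bits a z -> `|y - z| <= eta) ->
  eta `^ p + 2 `^ p * (L `^ p + M `^ p) * (#|{ffun 'I_K -> bool}|%:R * th)
    + 2 `^ p * kap <= k ->
  (0 < n)%N ->
  (forall b, `|n%:R^-1 * (\sum_(i < n) \1_(bits a @^-1` [set b]) (x i)) -
     Pr P ((bits a \o X) @^-1` [set b])| <= th) ->
  n%:R^-1 * (\sum_(i < n) tailpow p L (x i)) <= kap ->
  `|RA P A (empirical n x) - rho X| <= e.
Proof.
move=> p1 mX XM M0 L0 eta0 cont grid kk n0 freq tail.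
have p0 : 0 <= p by rewrite (le_trans _ p1).
have mc := bits_mclass a mX.
have ninv0 : 0 <= n%:R^-1 :> R by rewrite invr_ge0.
have usum : \sum_(i < n) n%:R^-1 = 1 :> R.
  by rewrite sumr_const card_ord -[LHS]mulr_natl mulfV// pnatr_eq0 -lt0n.
have [f [mf fn bad]] := coupling naP (Ordinal n0) (fun i : 'I_n => bits a (x i)) mc
  (fun=> ninv0) usum.
rewrite (RA_empirical x mf fn); apply: cont.
  exact: (mclass_bmeas (fun i : 'I_n => x i) mf).
have mY : measurable_fun setT (fun w => x (f w)).
  exact: (mclass_fun (fun i : 'I_n => x i) mf).
pose S := [set w | bits a (x (f w)) <> (bits a \o X) w].
have mS : measurable S.
  exact: (mclass_preimage
    [set ij : 'I_n * {ffun 'I_K -> bool} | bits a (x ij.1) <> ij.2] (mclass_pair mf mc)).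
have badS : Pr P S <= #|{ffun 'I_K -> bool}|%:R * th.
  apply: (le_trans bad); rewrite mulr_natl -sumr_const ler_sum// => b _.
  rewrite distrC (le_trans _ (freq b))// le_eqVlt; apply/orP; left; apply/eqP.
  congr `|_ - _|; rewrite mulr_sumr [LHS]big_mkcond/=; apply: eq_bigr => i _.
  rewrite indicE; case: ifPn => [/eqP bi|/eqP bi].
    by rewrite mem_set ?mulr1.
  by rewrite memNset ?mulr0.
pose C := 2 `^ p * (L `^ p + M `^ p).
have C0 : 0 <= C by rewrite mulr_ge0 ?addr_ge0 ?powR_ge0.
have pw0 (r : R) : 0 <= r `^ p by exact: powR_ge0.
have mI : measurable_fun setT (\1_S : T -> R) by exact: measurable_indic.
have mG : measurable_fun setT (fun w => tailpow p L (x (f w))).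
  by apply: (measurableT_comp (measurable_tailpow p L)).
(* The factors 1 give the bound the shape required by [integral_lin]. *)
apply: (@le_trans _ _ (\int[P]_w (1 * (eta `^ p * 1 + C * \1_S w) +
    2 `^ p * tailpow p L (x (f w)))%:E)%E).
  apply: le_integral_EFin => // [||w].
  - by apply: measurable_normpow; exact: measurable_funB.
  - apply: measurable_funD; apply: measurable_funM => //.
    by apply: measurable_funD => //; apply: measurable_funM.
  - rewrite mul1r mulr1 indicE; case: (boolP (w \in S)) => [_|/negP Sw].
      rewrite mulr1 (le_trans (normpowD _ _ p0))// normrN.
      have Xp : `|X w| `^ p <= M `^ p.
        by apply: ge0_ler_powR; rewrite ?nnegrE.
      have Yp : `|x (f w)| `^ p <= L `^ p + tailpow p L (x (f w)).
        rewrite /tailpow; case: ifPn => [xL|_]; last by rewrite lerDr.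
        by rewrite addr0; apply: ge0_ler_powR; rewrite ?nnegrE.
      have := pw0 eta; have := pw0 2; rewrite /C; nra.
    rewrite mulr0 addr0 (le_trans (_ : _ <= eta `^ p))//; last first.
      by rewrite lerDl mulr_ge0// tailpow_ge0.
    apply: ge0_ler_powR; rewrite ?nnegrE// distrC; apply: grid => //.
    by apply: contrapT => bb; apply: Sw; rewrite mem_set// => eb; apply: bb.
have me : measurable_fun setT (fun w : T => eta `^ p * 1 + C * \1_S w).
  by apply: measurable_funD => //; apply: measurable_funM.
have e0 (w : T) : 0 <= eta `^ p * 1 + C * \1_S w.
  by rewrite mulr1; exact: addr_ge0 (pw0 eta) (mulr_ge0 C0 _).
have t0 (w : T) : 0 <= tailpow p L (x (f w)) by exact: tailpow_ge0.
have one0 (w : T) : 0 <= 1 :> R by [].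
have ind0 (w : T) : 0 <= \1_S w :> R by [].
rewrite (integral_lin P measurableT me mG e0 t0 ler01 (pw0 2)).
rewrite (integral_lin P measurableT (measurable_cst (1 : R)) mI one0 ind0 (pw0 eta) C0).
rewrite integral_Ecst mule1 mul1e (integral_indic_Pr P mS).
rewrite (integral_mclass (v := fun i : 'I_n => tailpow p L (x i)) mf); last first.
  by move=> i; exact: tailpow_ge0.
rewrite -!EFinM -!EFinD lee_fin (le_trans _ kk)// lerD//.
  by rewrite lerD2l -/C ler_wpM2l.
rewrite ler_wpM2l// (le_trans _ tail)// mulr_sumr ler_sum// => i _.
by rewrite fn mulrC.
Qed.
End Empirical.

Lemma measurable_psi {R : realType} (p : R) : measurable_fun setT (psi p : R -> R).
Proof.
by apply: measurable_funM => //; exact: (measurable_normpow p (@measurable_id _ R setT)).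
Qed.

Lemma psi_ge0 {R : realType} (p x : R) : 0 <= p -> 0 <= psi p x.
Proof. by move=> p0; rewrite mulr_ge0 ?invr_ge0 ?powR_ge0. Qed.

Section Robust.
Context {R : realType} {d : measure_display} {T : measurableType d}.
Variables (P : probability T R) (A : set (T -> R)).
Hypothesis naP : nonatomic P.
Hypothesis AS : acceptance_set P A.
Hypothesis CV : convex_acc A.
Hypothesis LI : law_invariant P A.
Local Notation rho := (rho A).

Lemma tailpow_unif (p : R) (N : set (probability R R)) (e : R) : 1 <= p ->
  unif_p_integrating p N -> 0 < e -> exists L, 0 <= L /\
    forall nu, N nu -> (\int[nu]_y (tailpow p L y)%:E <= e%:E)%E.
Proof.
move=> p1 uN e0; have p0 : 0 < p by rewrite (lt_le_trans _ p1).
have [M0 MP] := uN (e / p) (divr_gt0 e0 p0).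
(* L is chosen so that |y| > L forces psi p y >= M. *)
pose M := Num.max M0 0; pose L := (p * M) `^ p^-1.
have pM0 : 0 <= p * M by rewrite mulr_ge0 ?(ltW p0)// le_max lexx orbT.
exists L; split; first exact: powR_ge0.
move=> nu Nnu.
have {MP} MP := MP M (_ : M0 <= M) nu Nnu.
pose S := [set x : R | M <= psi p x].
have mpsi := measurable_psi p.
have mS : measurable S.
  rewrite (_ : S = setT `&` psi p @^-1` `[M, +oo[%classic); first exact: mpsi.
  by rewrite setTI; apply/seteqP; split => w /=; rewrite in_itv/= andbT.
have psi0 x := psi_ge0 x (ltW p0).
apply: (@le_trans _ _ (p%:E * \int[nu]_(x in S) (psi p x)%:E)%E); last first.
  rewrite -lee_pdivlMl// -EFinM mulrC; apply: MP.
  by rewrite le_max lexx.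
have mpsiS : measurable_fun S (fun x => (psi p x)%:E).
  exact/measurable_EFinP/measurable_funTS.
rewrite -(ge0_integralZl nu mS mpsiS) => [|x _|]; rewrite ?lee_fin ?(ltW p0)//.
rewrite [leRHS]integral_mkcond; apply: (ge0_le_integral nu measurableT).
- by move=> x _; rewrite lee_fin tailpow_ge0.
- by apply/measurable_EFinP; exact: measurable_tailpow.
- apply/(measurable_restrictT _ mS); exact: measurable_funeM mpsiS.
- move=> x _; rewrite /tailpow /patch; case: ifPn => [_|xL].
    by case: ifP => _; rewrite ?lee_fin// mulr_ge0 ?(ltW p0).
  rewrite -ltNge in xL; rewrite mem_set.
    by rewrite -EFinM lee_fin /psi mulrA mulfV ?gt_eqF// mul1r.
  rewrite /S /= /psi ler_pdivlMl//.
  have -> : p * M = L `^ p by rewrite /L -powRrM mulVf ?gt_eqF// powRr1.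
  by apply: ge0_ler_powR; rewrite ?nnegrE ?powR_ge0 ?(ltW p0) ?(ltW xL).
Qed.

Lemma ae_eq_preimage (X Y : T -> R) B : measurable_fun setT X -> measurable_fun setT Y ->
  {ae P, forall w, Y w = X w} -> measurable B -> P (X @^-1` B) = P (Y @^-1` B).
Proof.
move=> mX mY XY mB.
have mXB : measurable (X @^-1` B) by rewrite -[X in measurable X]setTI; exact: mX.
have mYB : measurable (Y @^-1` B) by rewrite -[X in measurable X]setTI; exact: mY.
rewrite (PrE P mXB) (PrE P mYB) -!integral_indic_Pr//; apply: ae_eq_integral => //.
- by apply/measurable_EFinP; exact: measurable_indic.
- by apply/measurable_EFinP; exact: measurable_indic.
- apply: filterS XY => w XYw _; rewrite !indicE.
  suff -> : (w \in X @^-1` B) = (w \in Y @^-1` B) by [].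
  by apply/idP/idP => /set_mem h; apply/mem_set; move: h; rewrite /preimage /= XYw.
Qed.

(** Half of th covers the distance from nu to the law of X, half the sampling error. Half of s
    covers all cell frequencies by Chebyshev, half the empirical tail by Markov. *)
Lemma RA_concentration (p : R) (X : T -> R) (M L k e s eta th kap : R) K
    (a : 'I_K -> R) (nu : probability R R) d' (T' : measurableType d')
    (Q : probability T' R) (Y : nat -> T' -> R) n :
  1 <= p -> measurable_fun setT X -> (forall w, `|X w| <= M) ->
  0 <= M -> 0 <= L -> 0 <= eta -> 0 < th -> 0 < kap -> e < s ->
  (forall Y, bmeas Y -> (mom P p (fun w => Y w - X w)%R <= k%:E)%E ->
     `|rho Y - rho X| <= e) ->
  (forall y z, `|y| <= M -> bits a y = bits a z -> `|y - z| <= eta) ->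
  eta `^ p + 2 `^ p * (L `^ p + M `^ p) * (#|{ffun 'I_K -> bool}|%:R * th)
    + 2 `^ p * kap <= k ->
  (forall b, `|Pr nu (bits a @^-1` [set b]) - Pr P ((bits a \o X) @^-1` [set b])|
     <= th / 2) ->
  (\int[nu]_y (tailpow p L y)%:E <= (kap * (s / 2))%:E)%E ->
  #|{ffun 'I_K -> bool}|%:R * (n%:R * (th / 2) ^+ 2)^-1 <= s / 2 ->
  iid Q nu Y -> (0 < n)%N ->
  1 - s <= Pr Q [set w | `|RA P A (empirical n (fun i => Y i w)) - rho X| < s].
Proof.
move=> p1 mX XM M0 L0 eta0 th0 kap0 es cont grid kk classes tail card iidY n0.
have [mY lY _] := iidY.
have mE b i : measurable (Y i @^-1` (bits a @^-1` [set b])).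
  by rewrite -[X in measurable X]setTI; apply: mY => //; exact: (@bits_mclass R _ R id).
have mb b : measurable (bits a @^-1` [set b]) by exact: (@bits_mclass R _ R id).
pose fr b w := n%:R^-1 * (\sum_(i < n) \1_(Y i @^-1` (bits a @^-1` [set b])) w) : R.
pose B1 b := [set w | th / 2 <= `|fr b w - Pr nu (bits a @^-1` [set b])|].
have B1P b : measurable (B1 b) /\ Pr Q (B1 b) <= (n%:R * (th / 2) ^+ 2)^-1.
  apply: (weak_law (E := fun i => Y i @^-1` (bits a @^-1` [set b]))) => //.
  - by rewrite divr_gt0.
  - by move=> i; rewrite /Pr lY.
  - by move=> i j ni nj ij; exact: (iid_pair iidY (mb b) ni nj ij).
have mt i : measurable_fun setT (fun w => tailpow p L (Y i w)).
  by apply: (measurableT_comp (measurable_tailpow p L)).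
pose tl w := n%:R^-1 * \sum_(i < n) tailpow p L (Y i w).
have mtl : measurable_fun setT tl.
  apply: measurable_funM => //.
  by apply: measurable_sum => i; exact: mt.
have tl0 w : 0 <= tl w.
  by rewrite mulr_ge0 ?invr_ge0// sumr_ge0// => i _; exact: tailpow_ge0.
pose B2 := [set w | kap <= tl w].
have mB2 : measurable B2.
  rewrite (_ : B2 = setT `&` tl @^-1` `[kap, +oo[%classic); first exact: mtl.
  by rewrite setTI; apply/seteqP; split => w /=; rewrite in_itv/= andbT.
have B2P : Pr Q B2 <= s / 2.
  have := markov_Pr Q mtl tl0 kap0.
  have -> : (\int[Q]_w (tl w)%:E = \int[nu]_y (tailpow p L y)%:E)%E.
    transitivity (n%:R^-1%:E * \int[Q]_w (\sum_(i < n) (tailpow p L (Y i w))%:E))%E.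
      rewrite -(ge0_integralZl Q measurableT).
      + by apply: eq_integral => w _; rewrite sumEFin.
      + apply: emeasurable_sum => i; exact/measurable_EFinP.
      + by move=> w _; apply: sume_ge0 => i _; rewrite lee_fin tailpow_ge0.
      + by rewrite lee_fin invr_ge0.
    rewrite (@ge0_integral_sum _ _ _ Q setT measurableT _
      (fun (i : 'I_n) w => (tailpow p L (Y i w))%:E)); last 2 first.
    + by move=> i; exact/measurable_EFinP.
    + by move=> i w _; rewrite lee_fin tailpow_ge0.
    rewrite (eq_bigr (fun=> \int[nu]_y (tailpow p L y)%:E)%E); last first.
      move=> i _; rewrite (ge0_integral_law (P := Q) (X := Y i)) ?preimage_setT//.
      + by move=> B mB; exact: lY.
      + by apply/measurable_EFinP; exact: measurable_tailpow.
      + by move=> y; rewrite lee_fin tailpow_ge0.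
    have : (\int[nu]_y (tailpow p L y)%:E)%E \is a fin_num.
      rewrite ge0_fin_numE ?(le_lt_trans tail) ?ltry//.
      by apply: integral_ge0 => y _; rewrite lee_fin tailpow_ge0.
    case: (\int[nu]_y _)%E => // r _; rewrite sumEFin -EFinM; congr (_%:E).
    by rewrite sumr_const card_ord -[r *+ n]mulr_natl mulKf// pnatr_eq0 -lt0n.
  move/le_trans => /(_ _ tail); rewrite (PrE Q mB2) -EFinM lee_fin.
  by rewrite ler_pM2l.
pose Bad := \bigcup_b B1 b `|` B2.
have mB1 : measurable (\bigcup_b B1 b).
  by apply: fin_bigcup_measurable => [|b _]; [exact: finite_finset|have [] := B1P b].
have PBad : Pr Q Bad <= s.
  rewrite (le_trans (le_PrU Q mB1 mB2))// [leRHS](splitr s) lerD//.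
  rewrite (le_trans (le_Pr_bigcup Q _))//; first by move=> b; have [] := B1P b.
  rewrite (le_trans _ card)// mulr_natl -sumr_const ler_sum// => b _.
  by have [] := B1P b.
have mBad : measurable Bad by exact: measurableU.
have := PrC Q mBad.
suff : Pr Q (~` Bad) <=
    Pr Q [set w | `|RA P A (empirical n (fun i => Y i w)) - rho X| < s] by lra.
apply: le_Pr; first exact: measurableC.
  have mRA := measurable_RA_empirical naP AS LI n0 mY.
  rewrite -[X in measurable X]setTI.
  exact: (mRA measurableT _ (measurable_dist_lt (rho X) s)).
move=> w /not_orP[nB1 nB2] /=; apply: le_lt_trans es.
apply: (RA_close (x := fun i => Y i w) naP LI p1 mX XM M0 L0 eta0 cont grid kk n0).
- move=> b; have := classes b.
  have : `|fr b w - Pr nu (bits a @^-1` [set b])| < th / 2.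
    by rewrite ltNge; apply/negP => h; apply: nB1; exists b.
  rewrite [X in n%:R^-1 * X](_ : _ = \sum_(i < n) \1_(Y i @^-1` (bits a @^-1` [set b]))
    w)//.
  rewrite -/(fr b w) => h1 h2.
  rewrite (le_trans (ler_distD (Pr nu (bits a @^-1` [set b])) _ _))//.
  by rewrite [leRHS](splitr th) lerD// ltW.
- by rewrite leNgt; apply/negP => h; apply: nB2; exact: ltW.
Qed.

Lemma bounded_near0_robust p : 1 <= p -> bounded_near0 P A p -> p_robust P A p.
Proof.
move=> p1 bdd N NM uN mu Nmu e e0; have p0 : 0 < p by rewrite (lt_le_trans _ p1).
(* Both empirical risks will concentrate within s of [rho X], and [prohorov_concentrated] doubles
   s. *)
pose s := e / 2; have s0 : 0 < s by rewrite divr_gt0.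
have [X' [LX' Xmu']] := NM mu Nmu.
have [M [M0 XM']] := Linf_clip LX'.
pose X := clip M \o X'; have [mX' _] := LX'.
have bX : bmeas X by exact: clip_bmeas.
have mX : measurable_fun setT X by have [] := bX.
have Xmu B : measurable B -> P (X @^-1` B) = mu B.
  by move=> mB; rewrite -Xmu'//; apply: ae_eq_preimage.
have XM w : `|X w| <= M by exact: norm_clip.
have [k [k0 cont]] := rho_continuous AS CV p1 bdd bX (divr_gt0 s0 (ltr0n R 2)).
pose C := 2 `^ p : R; have C0 : 0 < C by exact: powR_gt0.
pose eta := (k / 4) `^ p^-1; have eta0 : 0 < eta by rewrite powR_gt0// divr_gt0.
have etaE : eta `^ p = k / 4.
  by rewrite -powRrM mulVf ?gt_eqF// powRr1// divr_ge0// ltW.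
pose kap := k / (4 * C); have kap0 : 0 < kap by rewrite divr_gt0// mulr_gt0.
have [L [L0 tail]] := tailpow_unif p1 uN (mulr_gt0 kap0 (divr_gt0 s0 (ltr0n R 2))).
have [K gridK] := good_grid mu M0 eta0.
pose F : R := #|{ffun 'I_K -> bool}|%:R; have F0 : 0 <= F by [].
pose D := C * (L `^ p + M `^ p) * F.
have D0 : 0 <= D by rewrite !mulr_ge0 ?addr_ge0 ?powR_ge0// ltW.
(* The mismatched cells then contribute at most k / 4, as do eta and kap; the sum stays below k. *)
pose th := k / (4 * (D + 1)).
have th0 : 0 < th by rewrite divr_gt0// mulr_gt0// ltr_wpDl.
have [a [r [r0 grid nearr]]] := gridK (th / 4) (divr_gt0 th0 (ltr0n R 4)).
have kk : eta `^ p + 2 `^ p * (L `^ p + M `^ p) *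
    (#|{ffun 'I_K -> bool}|%:R * th) + 2 `^ p * kap <= k.
  have -> : 2 `^ p * (L `^ p + M `^ p) * (#|{ffun 'I_K -> bool}|%:R * th) = D * th.
    by rewrite /D /F /C; ring.
  have -> : 2 `^ p * kap = k / 4 by rewrite -/C /kap; field; rewrite gt_eqF.
  have : D * th <= k / 4.
    rewrite /th invfM mulrA mulrA (mulrC _ k) -mulrA -mulrA ler_pM2l//.
    rewrite mulrC -mulrA -[leRHS]mulr1 ler_pM2l ?invr_gt0//.
    by rewrite mulrC ler_pdivrMr ?ltr_wpDl// mul1r lerDl.
  by rewrite etaE; lra.
pose q := F / ((th / 2) ^+ 2 * (s / 2)).
have q0 : 0 <= q by rewrite divr_ge0// mulr_ge0 ?sqr_ge0// divr_ge0// ltW.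
have conc (nu : probability R R) d' (T' : measurableType d') (Q : probability T' R)
    (Y : nat -> T' -> R) n : N nu ->
    (forall b, `|Pr nu (bits a @^-1` [set b]) - Pr mu (bits a @^-1` [set b])| <= th / 2) ->
    iid Q nu Y -> (0 < n)%N -> (Num.bound q <= n)%N ->
    1 - s <= Pr Q [set w | `|RA P A (empirical n (fun i => Y i w)) - rho X| < s].
  move=> Nnu cl iidY n0 qn.
  apply: (RA_concentration p1 mX XM M0 L0 (ltW eta0) th0 kap0 _ cont grid kk _ (tail nu Nnu)
    _ iidY n0).
  - by rewrite ltr_pdivrMr// ltr_pMr// ltr1n.
  - move=> b; have -> : Pr P ((bits a \o X) @^-1` [set b]) = Pr mu (bits a @^-1` [set b]).
      by rewrite /Pr -Xmu//; exact: (@bits_mclass R _ R id).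
    exact: cl.
  - have nq : q <= n%:R.
      by rewrite (le_trans (ltW (archi_boundP q0)))// ler_nat.
    have n0' : 0 < n%:R :> R by rewrite ltr0n.
    rewrite ler_pdivrMr; last by rewrite mulr_gt0// exprn_gt0// divr_gt0.
    move: nq; rewrite /q ler_pdivrMr; last first.
      by apply: mulr_gt0; [apply: exprn_gt0; exact: divr_gt0|exact: divr_gt0].
    by move=> /le_trans; apply; rewrite le_eqVlt; apply/orP; left; apply/eqP; ring.
(* Puts the Prohorov distance strictly below both r and th / 4, so that [prohorov_bits] yields th /
   2. *)
pose dl := Num.min (r / 2) (th / 8).
have dl0 : 0 < dl by rewrite lt_min; apply/andP; split; exact: divr_gt0.
exists dl; split => //; exists (Num.bound q) => nu Nnu close d1 T1 P1 X1 _ iid1 d2 T2 P2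
  X2 _ iid2 n n0 qn.
have pro : prohorov mu nu <= dl.
  rewrite -lee_fin (le_trans _ close)// leeDl//.
have [mX1 _ _] := iid1; have [mX2 _ _] := iid2.
have m1 := measurable_RA_empirical naP AS LI n0 mX1.
have m2 := measurable_RA_empirical naP AS LI n0 mX2.
have -> : e = 2 * s by rewrite /s; field.
apply: (prohorov_concentrated (mu := law P1 m1) (nu := law P2 m2) (r := rho X)) => //.
- apply: (conc mu _ _ P1 X1 n Nmu _ iid1) => // b.
  by rewrite subrr normr0 divr_ge0// ltW.
- apply: (conc nu _ _ P2 X2 n Nnu _ iid2) => // b.
  have pr : prohorov mu nu < Num.min r (th / 4).
    rewrite (le_lt_trans pro)// lt_min !gt_min; apply/andP; split; apply/orP.
      by left; rewrite ltr_pdivrMr// ltr_pMr// ltr1n.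
    by right; rewrite ltr_pM2l// ltf_pV2 ?posrE// ltr_nat.
  have -> : th / 2 = 2 * (th / 4) by field.
  apply: prohorov_bits pr _ _ _; first by rewrite ge_min lexx orbT.
  apply: le_trans nearr; apply: le_Pr; [exact: measurable_near|exact: measurable_near|].
  by move=> x [j xj]; exists j; rewrite (lt_le_trans xj)// ge_min lexx.
Qed.
End Robust.

(** * Continuity from robustness *)

Section IidSequence.
Context {R : realType} {d : measure_display} {T : measurableType d}.
Variable P : probability T R.
Hypothesis naP : nonatomic P.

(* [W n w] lists the first [n] classes of [w]; each cell of [W n] is split
   according to [p], independently of the past. *)
Lemma indep_classes (I : finType) (i0 : I) (p : I -> R) :
  (forall i, 0 <= p i) -> \sum_i p i = 1 ->
  exists c : nat -> T -> I, (forall n, mclass (c n)) /\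
    forall n (D : nat -> set I), Pr P (\bigcap_(i in `I_n) (c i @^-1` D i)) =
      \prod_(i < n) \sum_(k | k \in D i) p k.
Proof.
move=> p0 p1.
have /choice[F FP] : forall S : set T, exists f : T -> I, measurable S -> forall k,
    measurable (S `&` f @^-1` [set k]) /\ Pr P (S `&` f @^-1` [set k]) = Pr P S * p k.
  move=> S; have [mS|nS] := pselect (measurable S); last by exists (fun=> i0).
  have [||f fP] := @split_weights _ _ _ P naP I i0 S (fun k => Pr P S * p k) mS.
  - by move=> i; rewrite mulr_ge0 ?Pr_ge0.
  - by rewrite -mulr_sumr p1 mulr1.
  - by exists f => _; exact: fP.
pose W := fix W n (w : T) : seq I :=
  if n is n'.+1 then rcons (W n' w) (F (W n' @^-1` [set W n' w]) w) else [::].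
pose c n w := F (W n @^-1` [set W n w]) w.
have sW n w : size (W n w) = n by elim: n => //= n IH; rewrite size_rcons IH.
have cell n s k : W n @^-1` [set s] `&` c n @^-1` [set k] =
    W n @^-1` [set s] `&` F (W n @^-1` [set s]) @^-1` [set k].
  by apply/seteqP; split => w /= [Ws]; rewrite /c Ws.
have mW n s : measurable (W n @^-1` [set s]).
  elim: n s => [|n IH] s.
    have [->|s0] := pselect (s = [::]).
      by rewrite (_ : _ @^-1` _ = setT)//; apply/seteqP; split.
    rewrite (_ : _ @^-1` _ = set0)//; apply/seteqP; split => // w /= e.
    by apply: s0; rewrite -e.
  case/lastP: s => [|s k].
    rewrite (_ : _ @^-1` _ = set0)//; apply/seteqP; split => // w /=.
    by move/(congr1 size); rewrite size_rcons.
  rewrite (_ : _ @^-1` _ = W n @^-1` [set s] `&` F (W n @^-1` [set s]) @^-1` [set k]).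
    by have [] := FP _ (IH s) k.
  rewrite -cell; apply/seteqP; split => w /=.
    by move/eqP; rewrite eqseq_rcons => /andP[/eqP ? /eqP ?].
  by move=> [Ws <-]; rewrite /c Ws.
(* Tuples of fixed length form a finite type, so the past is again a finite partition. *)
pose Wt n w : n.-tuple I := Tuple (introT eqP (sW n w)).
have WtE n (t : n.-tuple I) : Wt n @^-1` [set t] = W n @^-1` [set val t].
  by apply/seteqP; split => w /= => [<-//|e]; apply: val_inj.
have mWt n : mclass (Wt n) by move=> t; rewrite WtE.
have mc n : mclass (c n).
  move=> k; rewrite (_ : _ @^-1` _ = \bigcup_(t : n.-tuple I)
      (W n @^-1` [set val t] `&` F (W n @^-1` [set val t]) @^-1` [set k])).
    apply: fin_bigcup_measurable => [|t _]; first exact: finite_finset.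
    by have [] := FP _ (mW n (val t)) k.
  apply/seteqP; split => [w cw|w [t _]]; last by rewrite -cell => -[].
  by exists (Wt n w) => //; rewrite -cell.
have Wnth n w i : (i < n)%N -> nth i0 (W n w) i = c i w.
  elim: n => // n IH; rewrite ltnS leq_eqVlt /= nth_rcons sW => /orP[/eqP ->|lt].
    by rewrite ltnn eqxx.
  by rewrite lt IH.
exists c; split => // n D; elim: n => [|n IH].
  by rewrite big_ord0 -(PrT P); congr (Pr P _); apply/seteqP; split.
rewrite big_ord_recr/= -IH.
pose E := [set t : n.-tuple I | forall i, (i < n)%N -> D i (nth i0 t i)].
have GE : \bigcap_(i in `I_n) (c i @^-1` D i) = Wt n @^-1` E.
  apply/seteqP; split => w /=.
    by move=> h i ni; rewrite Wnth//; exact: h.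
  by move=> h i ni; have := h i ni; rewrite Wnth.
have -> : \bigcap_(i in `I_n.+1) (c i @^-1` D i) =
    (fun w => (Wt n w, c n w)) @^-1` [set tk | E tk.1 /\ D n tk.2].
  apply/seteqP; split => w /=.
    move=> h; split; last exact: (h n (ltnSn n)).
    by move=> i ni; rewrite Wnth//; apply: h => /=; exact: ltnW.
  move=> [h1 h2] i /=; rewrite ltnS leq_eqVlt => /orP[/eqP -> //|ni].
  by have := h1 i ni; rewrite Wnth.
rewrite GE (Pr_preimage P _ (mclass_pair (mWt n) (mc n))) (Pr_preimage P E (mWt n)).
rewrite big_distrlr/= pair_big/=; apply: eq_big => [[t k]|[t k] _] /=.
  by apply/idP/andP => [/set_mem[? ?]|[/set_mem ? /set_mem ?]]; [split|]; apply/mem_set.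
rewrite WtE; have [_ <-] := FP _ (mW n (val t)) k; rewrite -cell; congr (Pr P _).
apply/seteqP; split => w /=; first by move=> [<- <-].
by move=> [e <-]; congr pair; exact: val_inj.
Qed.

(** One sequence of labels serves all v: it will be used both for the risk and for an injective
    numbering of the labels. *)
Lemma iid_simple (I : finType) (c0 : T -> I) (mc0 : mclass c0) :
  exists c : nat -> T -> I, (forall n, mclass (c n)) /\
    forall (v : I -> R) (mv : measurable_fun setT (v \o c0)),
      iid P (law P mv) (fun n => v \o c n).
Proof.
have [c [mc cP]] := indep_classes (c0 point) (fun k => Pr_ge0 P (c0 @^-1` [set k]))
  (sum_Pr P mc0).
exists c; split => // v mv.
have cD n D : Pr P (c n @^-1` D) = Pr P (c0 @^-1` D).
  have := cP n.+1 (fun k => if k == n then D else setT).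
  rewrite big_ord_recr/= eqxx big1 ?mul1r; last first.
    move=> i _; rewrite ifF; last by apply/negbTE; rewrite neq_ltn ltn_ord.
    rewrite -[RHS](sum_Pr P mc0); apply: eq_bigl => k.
    by apply/mem_set.
  rewrite (Pr_preimage P D mc0) => <-; congr (Pr P _); apply/seteqP; split => w /=.
    by move=> h k _; case: ifPn => // /eqP ->.
  by move=> h; have := h n (ltnSn n); rewrite eqxx.
split.
- by move=> n; exact: mclass_fun.
- move=> n B mB; rewrite lawE.
  rewrite [LHS](PrE P (mclass_preimage (v @^-1` B) (mc n))).
  rewrite [RHS](PrE P (mclass_preimage (v @^-1` B) mc0)); congr (_%:E).
  exact: (cD n (v @^-1` B)).
- move=> n B mB.
  have mI : measurable (\bigcap_(i in `I_n) (c i @^-1` (v @^-1` B i))).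
    apply: fin_bigcap_measurable => [|i _]; first exact: finite_II.
    exact: mclass_preimage.
  rewrite [LHS](PrE P mI) (cP n (fun i => v @^-1` B i)) -prodEFin.
  apply: eq_bigr => i _; rewrite -(Pr_preimage P _ mc0) -(cD i).
  exact/esym/(PrE P (mclass_preimage (v @^-1` B i) (mc i))).
Qed.

Lemma iid_cst (r : R) (mr : measurable_fun setT (fun _ : T => r)) :
  iid P (law P mr) (fun _ _ => r).
Proof.
split => [i|i B mB|n B mB]; [exact: measurable_cst|by rewrite lawE|].
have [h|/existsNP[i /not_implyP[ni nB]]] := pselect (forall i, (i < n)%N -> B i r).
  rewrite big1 => [|i _]; last first.
    rewrite (_ : _ @^-1` _ = setT) ?probability_setT//.
    by apply/seteqP; split => // w _; exact: h.
  rewrite (_ : \bigcap_(_ in _) _ = setT) ?probability_setT//.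
  by apply/seteqP; split => // w _ i; exact: h.
rewrite (bigD1 (Ordinal ni))//= (_ : _ @^-1` B i = set0); last first.
  by apply/seteqP; split.
rewrite measure0 mul0e (_ : \bigcap_(_ in _) _ = set0) ?measure0//.
by apply/seteqP; split => // w /(_ i ni).
Qed.
End IidSequence.

Section RobustConverse.
Context {R : realType} {d : measure_display} {T : measurableType d}.
Variables (P : probability T R) (A : set (T -> R)).
Hypothesis naP : nonatomic P.
Hypothesis AS : acceptance_set P A.
Hypothesis CV : convex_acc A.
Hypothesis LI : law_invariant P A.
Local Notation rho := (rho A).

(** Couple the sample with c. On a class b of positive mass the mean of the sample differs from v b
    by at most 2 K times the mismatch mass divided by that of b, so [rho_cond_mean] applies without
    any continuity of [rho]. *)
Lemma RA_lower (I : finType) (c : T -> I) (v : I -> R) (K eta th : R) n (y : nat -> I) :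
  mclass c -> (forall k, `|v k| <= K) -> 0 <= K -> (0 < n)%N ->
  (forall b, `|n%:R^-1 * (\sum_(i < n) (y i == b)%:R) - Pr P (c @^-1` [set b])| <= th) ->
  (forall b, 0 < Pr P (c @^-1` [set b]) ->
     2 * K * (#|I|%:R * th) <= eta * Pr P (c @^-1` [set b])) ->
  rho (v \o c) <= RA P A (empirical n (fun i => v (y i))) + eta.
Proof.
move=> mc vK K0 n0 freq small.
have ninv0 : 0 <= n%:R^-1 :> R by rewrite invr_ge0.
have usum : \sum_(i < n) n%:R^-1 = 1 :> R.
  by rewrite sumr_const card_ord -[LHS]mulr_natl mulfV// pnatr_eq0 -lt0n.
have [f [mf fn bad]] := coupling naP (Ordinal n0) (fun i : 'I_n => y i) mc
  (fun=> ninv0) usum.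
rewrite (RA_empirical LI (fun i => v (y i)) mf fn).
have bZ := mclass_bmeas (fun i : 'I_n => v (y i)) mf.
apply: (rho_cond_mean AS CV LI naP mc bZ) => b.
pose S := [set w | y (f w) <> c w].
have mS : measurable S.
  exact: (mclass_preimage [set ij : 'I_n * I | y ij.1 <> ij.2] (mclass_pair mf mc)).
have badS : Pr P S <= #|I|%:R * th.
  apply: (le_trans bad); rewrite mulr_natl -sumr_const ler_sum// => k _.
  rewrite distrC (le_trans _ (freq k))// le_eqVlt; apply/orP; left; apply/eqP.
  congr `|_ - _|; rewrite mulr_sumr [LHS]big_mkcond/=; apply: eq_bigr => i _.
  by case: eqP; rewrite ?mulr1 ?mulr0.
have bI : bmeas (\1_S : T -> R).
  split; first exact: measurable_indic.
  by exists 1 => w; rewrite indicE; case: (w \in S); rewrite ?normr1 ?normr0.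
have bB : bmeas (fun w : T => v b + 2 * K * \1_S w).
  exact/bmeasD/bmeasZ/bI/bmeas_cst.
have mSb : measurable (S `&` c @^-1` [set b]) by exact: measurableI.
apply: (@le_trans _ _ (v b * Pr P (c @^-1` [set b]) +
    2 * K * Pr P (S `&` c @^-1` [set b]))).
  apply: (@le_trans _ _ (\int[P]_(w in c @^-1` [set b]) (v b + 2 * K * \1_S w))).
    apply: le_Rintegral => //; [exact: bmeas_integrable|exact: bmeas_integrable|].
    move=> w /= cb; rewrite indicE; case: (boolP (w \in S)) => [_|/negP Sw].
      by have := vK b; have := vK (y (f w)); rewrite !ler_norml mulr1; lra.
    rewrite mulr0 addr0 -cb; have [->//|ne] := pselect (y (f w) = c w).
    by exfalso; apply: Sw; rewrite mem_set.
  rewrite RintegralD//; last 2 first.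
  - exact: (bmeas_integrable P (bmeas_cst (v b)) (mc b)).
  - exact: (bmeas_integrable P (bmeasZ (2 * K) bI) (mc b)).
  rewrite Rintegral_cst// RintegralZl//; last exact: bmeas_integrable.
  by rewrite /Rintegral integral_indic.
have [Pb|Pb] := ltP 0 (Pr P (c @^-1` [set b])).
  rewrite [leRHS]mulrDl lerD2l (le_trans _ (small b Pb))// ler_wpM2l ?mulr_ge0//.
  by rewrite (le_trans _ badS)// le_Pr// => w [].
have Pb0 : Pr P (c @^-1` [set b]) = 0 by apply/eqP; rewrite eq_le Pb Pr_ge0.
have : Pr P (S `&` c @^-1` [set b]) <= 0.
  by rewrite -Pb0 le_Pr// => w [].
have := Pr_ge0 P (S `&` c @^-1` [set b]).
by rewrite Pb0 !mulr0 add0r => h1 h2; rewrite (_ : Pr _ _ = 0) ?mulr0//; lra.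
Qed.

Lemma int_psi_law (p : R) X (mX : measurable_fun setT X) : 0 < p ->
  int_psi p (law P mX) = ((p^-1)%:E * mom P p X)%E.
Proof.
move=> p0; have mpsi := measurable_psi p.
have psi0 x := psi_ge0 x (ltW p0).
have mpsiE : measurable_fun setT (fun x => (psi p x)%:E) by exact/measurable_EFinP.
have psiE0 (y : R) : (0 <= (psi p y)%:E)%E by rewrite lee_fin.
rewrite /int_psi (ge0_integral_law (nu := law P mX) mX (fun B _ => erefl) measurableT
  mpsiE psiE0) preimage_setT.
have mN : measurable_fun setT (fun w => (`|X w| `^ p)%:E).
  by apply/measurable_EFinP; exact: measurable_normpow.
rewrite /mom -(ge0_integralZl P measurableT mN) => [//|w _|]; rewrite lee_fin.
  exact: powR_ge0.
by rewrite invr_ge0 ltW.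
Qed.

(* Robustness at the Dirac mass at [0], along the laws of simple [Y k -> 0] in
   [L^p]: the empirical risks of [Y k] stay near [rho 0], but converge to values at
   least [rho (Y k)]. *)
Lemma robust_simple p : 1 <= p -> p_robust P A p -> exists e, 0 < e /\
  forall (I : finType) (c : T -> I) (v : I -> R), mclass c ->
    (mom P p (v \o c) <= e%:E)%E -> rho (v \o c) <= rho (fun=> 0) + 2.
Proof.
move=> p1 rob; have p0 : 0 < p by rewrite (lt_le_trans _ p1).
apply: contrapT => /forallNP nex.
pose simple (X : T -> R) := exists (I : finType) (c : T -> I) (v : I -> R),
  mclass c /\ X = v \o c.
have ex k : exists X, [/\ simple X, (mom P p X <= (k.+1%:R^-1)%:E)%E
    & rho (fun=> 0) + 2 < rho X].
  apply: contrapT => /forallNP nX; apply: (nex k.+1%:R^-1); split; first by rewrite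
    invr_gt0.
  move=> I c v mc Xk; rewrite leNgt; apply/negP => lt; apply: (nX (v \o c)); split => //.
  by exists I, c, v.
have /choice[Y' Y'P] := ex.
pose Y k := if k is k'.+1 then Y' k' else (fun=> 0) : T -> R.
(* At k = 0 the bound is 0, by the convention on the inverse of 0, and so is the moment. *)
have Ymom k : (mom P p (Y k) <= (k%:R^-1)%:E)%E.
  case: k => [|k] /=; last by have [] := Y'P k.
  rewrite /mom (_ : (fun _ => _) = (fun=> 0%:E)) ?integral_Ecst ?invr0//.
  by apply/funext => w; rewrite normr0 powR0// gt_eqF.
have bY k : bmeas (Y k).
  case: k => [|k] /=; first exact: bmeas_cst.
  by have [[I [c [v [mc ->]]]] _ _] := Y'P k; exact: mclass_bmeas.
have mY k : measurable_fun setT (Y k) by have [] := bY k.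
have /choice[b bP] : forall k, exists K, 0 <= K /\ forall w, `|Y k w| <= K.
  by move=> k; exact: bmeas_norm.
pose N := [set mu | exists k, mu = law P (mY k)].
have NM mu : N mu -> Minf P mu.
  by move=> [k ->]; exists (Y k); split => //; exact: bmeas_Linf.
have mpsi := measurable_psi p.
have psi0 x := psi_ge0 x (ltW p0).
have mpsiE (S : set R) : measurable_fun S (fun x => (psi p x)%:E).
  exact/measurable_EFinP/measurable_funTS.
have mS M : measurable [set x : R | M <= psi p x].
  rewrite (_ : [set _ | _] = setT `&` psi p @^-1` `[M, +oo[%classic); first exact: mpsi.
  by rewrite setTI; apply/seteqP; split => w /=; rewrite in_itv/= andbT.
have uN : unif_p_integrating p N.
  move=> e e0; pose n := Num.bound e^-1.
  have nP k : (n <= k)%N -> (k%:R^-1 : R) <= e.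
    move=> nk; have kn : e^-1 < k%:R.
      by rewrite (lt_le_trans (archi_boundP _)) ?ler_nat// invr_ge0 ltW.
    rewrite -[e]invrK lef_pV2 ?posrE ?invr_gt0//; first exact: ltW.
    by rewrite (lt_trans _ kn)// invr_gt0.
  (* Beyond this level the first n laws have no mass, and the total moment of each remaining law is
     already at most e. *)
  exists (1 + \sum_(k < n) psi p (b k)) => M MM _ [k ->].
  have [kn|nk] := ltnP k n.
    have psiE0 (y : R) : (0 <= (psi p y)%:E)%E by rewrite lee_fin.
    rewrite (ge0_integral_law (nu := law P (mY k)) (mY k) (fun B _ => erefl) (mS M)
      (mpsiE _) psiE0).
    rewrite (_ : _ @^-1` _ = set0) ?integral_set0 ?lee_fin ?(ltW e0)//.
    apply/seteqP; split => // w /=; rewrite leNgt => /negP; apply.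
    apply: lt_le_trans MM; rewrite (bigD1 (Ordinal kn))//=.
    have : psi p (Y k w) <= psi p (b k).
      have [bk0 bk] := bP k; rewrite ler_wpM2l ?invr_ge0 ?(ltW p0)//.
      by apply: ge0_ler_powR; rewrite ?nnegrE ?(ltW p0) ?normr_ge0// (ger0_norm bk0).
    have : 0 <= \sum_(i < n | i != Ordinal kn) psi p (b i) by exact: sumr_ge0.
    by lra.
  apply: (@le_trans _ _ (int_psi p (law P (mY k)))).
    by apply: ge0_subset_integral => // x _; rewrite lee_fin.
  rewrite int_psi_law// lee_pdivrMl// -EFinM (le_trans (Ymom k))// lee_fin.
  by rewrite (le_trans (nP k nk))// ler_peMl// ltW.
have h0 : 0 < 2^-1 :> R by [].
have [dl [dl0 [n0 robP]]] := rob N NM uN (law P (mY 0%N)) (ex_intro _ 0%N erefl) _ h0.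
pose s := dl / 4; have s0 : 0 < s by rewrite divr_gt0.
(* By Markov, moment s^p s gives mass at most s outside the ball of radius s, hence Prohorov
   distance at most 2 s = dl / 2; the other dl / 2 is for the moments. *)
pose m := Num.min (dl / 2) (s `^ p * s).
have m0 : 0 < m by rewrite lt_min divr_gt0//= mulr_gt0// powR_gt0.
pose k := (Num.bound m^-1).+1.
have km : (k%:R^-1 : R) <= m.
  have kn : m^-1 < k%:R.
    by rewrite (lt_trans (archi_boundP _)) ?ltr_nat// invr_ge0 ltW.
  rewrite -[m]invrK lef_pV2 ?posrE ?invr_gt0//; first exact: ltW.
have conc j : (mom P p (Y j) <= m%:E)%E ->
    1 - s <= Pr (law P (mY j)) [set x | `|x - 0| < s].
  move=> Yj; have := markov_Pr P (measurable_normpow p (mY j)) (fun w => powR_ge0 _ _)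
    (powR_gt0 p s0).
  pose Z := [set w | s `^ p <= `|Y j w| `^ p].
  have mZ : measurable Z.
    rewrite (_ : Z = setT `&` (fun w => `|Y j w| `^ p) @^-1` `[s `^ p, +oo[%classic).
      exact: measurable_normpow.
    by rewrite setTI; apply/seteqP; split => w /=; rewrite in_itv/= andbT.
  rewrite -/Z (PrE P mZ) -EFinM => /le_trans/(_ Yj); rewrite lee_fin => PZ.
  have {}PZ : Pr P Z <= s.
    rewrite -(ler_pM2l (powR_gt0 p s0)) (le_trans PZ)//.
    by rewrite ge_min lexx orbT.
  have : Pr P (~` Z) <= Pr (law P (mY j)) [set x | `|x - 0| < s].
    have mD := measurable_dist_lt (0 : R) s.
    have mYD : measurable (Y j @^-1` [set x | `|x - 0| < s]).
      by rewrite -[X in measurable X]setTI; exact: (mY j).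
    have -> : Pr (law P (mY j)) [set x | `|x - 0| < s] =
      Pr P (Y j @^-1` [set x | `|x - 0| < s]) by [].
    apply: le_Pr => //; first exact: measurableC.
    move=> w Zw /=; rewrite subr0 ltNge; apply/negP => sY; apply: Zw.
    by apply: ge0_ler_powR; rewrite ?nnegrE ?(ltW p0) ?(ltW s0).
  by rewrite PrC//; lra.
have Yk : (mom P p (Y k) <= m%:E)%E by rewrite (le_trans (Ymom k))// lee_fin.
have Y0 : (mom P p (Y 0%N) <= 0)%E by have := Ymom 0%N; rewrite invr0.
have Y00 : mom P p (Y 0%N) = 0%E by apply/eqP; rewrite eq_le Y0 mom_ge0.
have close : ((prohorov (law P (mY 0%N)) (law P (mY k)))%:E +
    `|int_psi p (law P (mY 0%N)) - int_psi p (law P (mY k))| <= dl%:E)%E.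
  have -> : dl = 2 * s + dl / 2 by rewrite /s; field.
  rewrite EFinD; apply: leeD.
    rewrite lee_fin; apply: (prohorov_concentrated s0); last exact: conc.
    by apply: conc; rewrite (le_trans Y0)// lee_fin ltW.
  rewrite !int_psi_law// Y00 mule0 sub0e abseN gee0_abs; last first.
    by rewrite mule_ge0 ?mom_ge0// lee_fin invr_ge0 ltW.
  rewrite lee_pdivrMl// -EFinM (le_trans Yk)// lee_fin.
  rewrite (@le_trans _ _ (dl / 2))//; first by rewrite ge_min lexx.
  by rewrite ler_peMl// divr_ge0// ltW.
have [[I [c [v [mc YE]]]] _ rhoY] : [/\ simple (Y k), True & rho (fun=> 0) + 2 < rho (Y k)].
  by have [] := Y'P (Num.bound m^-1).
have [C [mC iidC]] := iid_simple naP mc.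
have iid0 : iid P (law P (mY 0%N)) (fun _ _ => 0) := iid_cst P (mY 0%N).
have iidk : iid P (law P (mY k)) (fun n => v \o C n).
  by move: (mY k); rewrite YE => mYk; exact: iidC.
have [dm [dm0 dmP]] := pos_lower_bound (fun b => Pr P (c @^-1` [set b])).
pose K := \sum_i `|v i|; have K0 : 0 <= K by exact: sumr_ge0.
have vK i : `|v i| <= K by rewrite /K (bigD1 i)//= lerDl sumr_ge0.
pose F : R := #|I|%:R; have F0 : 0 <= F by [].
have KF0 : 0 <= 2 * K * F by rewrite !mulr_ge0.
(* Makes the hypothesis of [RA_lower] true with eta = 1. *)
pose th := dm / (2 * K * F + 1).
have th0 : 0 < th by rewrite divr_gt0// ltr_wpDl.
have KFth : 2 * K * (F * th) <= dm.
  rewrite /th mulrA mulrA ler_pdivrMr ?ltr_wpDl// mulrC ler_pM2l//.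
  by rewrite lerDl.
pose q := 8 * F / th ^+ 2.
have q0 : 0 <= q by rewrite divr_ge0 ?sqr_ge0// mulr_ge0.
pose n := maxn n0 (Num.bound q).+1.
have n_gt0 : (0 < n)%N by rewrite leq_max orbT.
have qn : q <= n%:R.
  rewrite (le_trans (ltW (archi_boundP q0)))// ler_nat.
  by rewrite leq_max leqnSn orbT.
have small : F * (n%:R * th ^+ 2)^-1 <= 1 / 8.
  rewrite ler_pdivrMr; last by rewrite mulr_gt0 ?exprn_gt0// ltr0n.
  by move: qn; rewrite /q ler_pdivrMr ?exprn_gt0//; lra.
(* [iid] concerns real variables; an injective numbering turns label events into Borel events. *)
pose g (i : I) : R := (enum_rank i)%:R.
have gI : injective g.
  move=> i j /eqP; rewrite eqr_nat => /eqP/val_inj; exact: enum_rank_inj.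
have gE i (h : T -> I) : (g \o h) @^-1` [set g i] = h @^-1` [set i].
  by apply/seteqP; split => w /= => [/gI|->].
have iidg := iidC g (mclass_fun g mc).
have CE i j : Pr P (C j @^-1` [set i]) = Pr P (c @^-1` [set i]).
  have [_ /(_ j [set g i] (measurable_set1 _)) + _] := iidg.
  by rewrite lawE /Pr !gE => ->.
pose fr b' w : R := n%:R^-1 * (\sum_(i < n) \1_(C i @^-1` [set b']) w).
pose B1 b' := [set w | th <= `|fr b' w - Pr P (c @^-1` [set b'])|].
have B1P b' : measurable (B1 b') /\ Pr P (B1 b') <= (n%:R * th ^+ 2)^-1.
  apply: (weak_law (E := fun i => C i @^-1` [set b'])) => //.
  - by move=> i; exact: mC.
  - move=> i j ni nj ij.
    have := iid_pair iidg (measurable_set1 (g b')) ni nj ij.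
    by rewrite !gE => ->; rewrite /Pr lawE gE.
pose Bad := \bigcup_b B1 b.
have mBad : measurable Bad.
  by apply: fin_bigcup_measurable => [|b' _]; [exact: finite_finset|have [] := B1P b'].
have PBad : Pr P Bad <= 1 / 8.
  rewrite (le_trans (le_Pr_bigcup P _))//; first by move=> b'; have [] := B1P b'.
  rewrite (le_trans _ small)// /F mulr_natl -sumr_const ler_sum// => b' _.
  by have [] := B1P b'.
have [mX0 _ _] := iid0; have [mXk _ _] := iidk.
have m1 := measurable_RA_empirical naP AS LI n_gt0 mX0.
have m2 := measurable_RA_empirical naP AS LI n_gt0 mXk.
have : prohorov (law P m1) (law P m2) <= 2^-1.
  exact: (robP _ (ex_intro _ k erefl) close _ _ P _ naP iid0 _ _ P _ naP iidk n n_gt0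
    (leq_maxl _ _)).
(* Since t < 3/4, near [rho 0] means below [rho 0 + 1], possible only on [Bad]; and 1 <= 1/8 + t is
   false. *)
move=> pr; have pr' : prohorov (law P m1) (law P m2) < 3 / 4 by lra.
have [t [t0 t34 tP]] := prohorov_lt pr'.
have [+ _] := tP _ (measurable_set1 (rho (fun=> 0))).
have -> : Pr (law P m1) [set rho (fun=> 0)] = 1.
  rewrite -(PrT P) /Pr lawE; congr (fine (P _)); apply/seteqP; split => // w _ /=.
  have [f [mf fn]] := uniform_partition naP n_gt0.
  exact: (RA_empirical LI (fun=> 0) mf fn).
have : Pr (law P m2) (nbhd_set [set rho (fun=> 0)] t) <= Pr P Bad.
  rewrite /Pr lawE -/(Pr P _) -/(Pr P Bad); apply: le_Pr => //.
    rewrite -[X in measurable X]setTI.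
    exact: (m2 measurableT _ (measurable_nbhd_set _ _)).
  move=> w /= [_ -> near0]; apply: contrapT => nBad.
  have : rho (v \o c) <= RA P A (empirical n (fun i => v (C i w))) + 1.
    apply: (RA_lower (th := th) (y := fun i => C i w) mc vK K0 n_gt0).
      move=> b'; have /ltW : `|fr b' w - Pr P (c @^-1` [set b'])| < th.
        by rewrite ltNge; apply/negP => h; apply: nBad; exists b'.
      rewrite /fr (eq_bigr (fun i : 'I_n => (C i w == b')%:R))// => i _.
      rewrite indicE; suff -> : (w \in C i @^-1` [set b']) = (C i w == b') by [].
      by apply/idP/eqP => [/set_mem|e]; [|exact/mem_set].
    by move=> b' b'0; rewrite mul1r (le_trans KFth)// dmP.
  by move: near0 rhoY; rewrite YE ltr_norml => /andP[? ?]; lra.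
lra.
Qed.

Lemma robust_bounded_near0 p : 1 <= p -> p_robust P A p -> bounded_near0 P A p.
Proof.
move=> p1 rob; have p0 : 0 < p by rewrite (lt_le_trans _ p1).
have [e [e0 eP]] := robust_simple p1 rob.
pose C := 2 `^ p : R; have C0 : 0 < C by exact: powR_gt0.
(* X and the simple approximation error contribute C (k + k) = e. *)
pose k := e / (2 * C); have k0 : 0 < k by rewrite divr_gt0// mulr_gt0.
pose eta := k `^ p^-1; have eta0 : 0 < eta by exact: powR_gt0.
have etaE : eta `^ p = k by rewrite -powRrM mulVf ?gt_eqF// powRr1// ltW.
exists k, (rho (fun=> 0) + 2 + eta); split => // X bX Xk; have [mX _] := bX.
have [I [c [v [mc vX]]]] := simple_approx P bX eta0.
have bv := mclass_bmeas v mc; have [mv _] := bv.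
have mD : measurable_fun setT (fun w => v (c w) - X w) by exact: measurable_funB.
have : rho (v \o c) <= rho (fun=> 0) + 2.
  apply: eP => //; rewrite (_ : v \o c = fun w => X w + (v (c w) - X w)); last first.
    by apply/funext => w /=; ring.
  apply: (le_trans (momD P (ltW p0) mX mD)).
  have Dk : (mom P p (fun w => v (c w) - X w)%R <= k%:E)%E.
    rewrite -etaE -(integral_Ecst P); apply: le_integral_EFin => [//|||w|w].
    - exact: measurable_normpow.
    - exact: measurable_cst.
    - exact: powR_ge0.
    - apply: ge0_ler_powR; rewrite ?nnegrE ?(ltW p0) ?(ltW eta0)//.
      by rewrite distrC.
  apply: (@le_trans _ _ (C%:E * (k%:E + k%:E))%E).
    by apply: lee_wpmul2l; [rewrite lee_fin ltW|exact: leeD].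
  rewrite -EFinD -EFinM lee_fin /k le_eqVlt; apply/orP; left; apply/eqP.
  by field; rewrite gt_eqF.
have : rho X <= rho (v \o c) + eta.
  apply: (rho_shift_le AS); [exact: bmeas_Linf|exact: bmeas_Linf|].
  by apply: aeW => w /=; have := vX w; rewrite ler_norml; lra.
lra.
Qed.
End RobustConverse.

Theorem theorem5p3 (R : realType) (d : measure_display) (T : measurableType d)
  (P : probability T R) (A : set (T -> R)) :
  nonatomic P -> acceptance_set P A -> convex_acc A -> law_invariant P A ->
  (forall p : R, 1 <= p -> (p_robust P A p <-> Lp_interior_nonempty P p A)) /\
  Index_qr P A = einv (Index_fin P A).
Proof.
move=> naP AS CV LI.
have equiv (p : R) : 1 <= p -> (p_robust P A p <-> Lp_interior_nonempty P p A).
  move=> p1; split => [rob|int].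
    exact: (bounded_near0_interior AS p1 (robust_bounded_near0 naP AS CV LI p1 rob)).
  exact: (bounded_near0_robust naP AS CV LI p1
    (interior_bounded_near0 naP AS CV LI p1 int)).
split; first exact: equiv.
rewrite /Index_qr /Index_fin; congr (einv (ereal_inf (image _ _))).
by apply/seteqP; split => p [p1 /(equiv p p1)].
Qed.
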